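(* Let $L_\delta:L^2\to L^2$, $\delta\in[0,\bar\delta)$, be integral-preserving integral operators $L_\delta f(x)=\int k_\delta(x,y)f(y)\,dy$ with stochastic kernels $k_\delta\in L^2([0,1]^2)$ of the form $$k_\delta=k_0+\delta\cdot\dot k+r_\delta,\qquad \dot k,r_\delta\in L^2([0,1]^2),\quad \|r_\delta\|_{L^2([0,1]^2)}=o(\delta).$$ Suppose $L_0$ satisfies (A1): $\lim_{n\to\infty}\|L_0^ng\|_2=0$ for every $g\in V$. Then $\dot k\in V_{\ker}$, and the system has linear response for this perturbation, given explicitly by $$\lim_{\delta\to0}\frac{f_\delta-f_0}{\delta}=(\mathrm{Id}-L_0)^{-1}\int\dot k(x,y)f_0(y)\,dy$$ with convergence in $L^2$.
   Context: $L^2=L^2([0,1],\mathbb R)$ with Lebesgue measure $m$; $V:=\{f\in L^2:\int f\,dm=0\}$; $V_{\ker}:=\{k\in L^2([0,1]^2):\int k(x,y)\,dx=0\text{ for a.e. }y\}$. Integral-preserving means $\int L_\delta g\,dm=\int g\,dm$ for all $g\in L^2$. A stochastic kernel is a nonnegative $k$ with $\int k(x,y)\,dx=1$ for a.e. $y$. $f_\delta$ denotes the invariant function of $L_\delta$ ($L_\delta f_\delta=f_\delta$) with $\int f_\delta\,dm=1$, which exists and is unique for all sufficiently small $\delta\ge0$. $(\mathrm{Id}-L_0)^{-1}:V\to V$ is the bounded inverse of $\mathrm{Id}-L_0$ on $V$, which exists under (A1). *)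

(* Defs.v *)
From HB Require Import structures.
From mathcomp Require Import all_boot all_order all_algebra.
From mathcomp Require Import all_classical all_reals all_analysis.

Set Implicit Arguments.
Unset Strict Implicit.
Unset Printing Implicit Defensive.

Import Order.TTheory GRing.Theory Num.Theory.
Import numFieldNormedType.Exports.

Local Open Scope classical_set_scope.
Local Open Scope ring_scope.

(* L^2([0,1]) is rendered by representatives: measurable functions on R with
   finite 2-norm for the Lebesgue measure restricted to [0,1], compared up to
   almost everywhere equality for that measure (the library quotient
   LspaceType has no algebraic structure). *)
Section Spaces.
Context {R : realType}.

Definition leb01 : set (measurableTypeR R) -> \bar R :=
  mrestr (@lebesgue_measure R) (measurable_itv `[0, 1]).

HB.instance Definition _ := Measure.on leb01.

Let leb01_fin : fin_num_fun leb01.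
Proof.
move=> U mU; rewrite ge0_fin_numE ?measure_ge0// /leb01 /mrestr.
rewrite (@le_lt_trans _ _ (lebesgue_measure (`[0, 1]%classic : set R)))//.
  by apply: le_measure; rewrite ?inE//; exact: measurableI.
by rewrite lebesgue_measure_itv/= lte_fin ltr01 EFinN sube0 ltry.
Qed.

HB.instance Definition _ := Measure_isFinite.Build _ _ _ leb01 leb01_fin.

Definition leb01sq :
    set (measurableTypeR R * measurableTypeR R) -> \bar R :=
  (leb01 \x leb01)%E.

HB.instance Definition _ := Measure.on leb01sq.

Definition L2 : set (R -> R) := [set f | f \in Lfun leb01 2%:E].

Definition L2norm (f : R -> R) : \bar R := 'N[leb01]_2%:E[EFin \o f]%E.

Definition L2ker : set (R * R -> R) := [set k | k \in Lfun leb01sq 2%:E].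

Definition L2kernorm (k : R * R -> R) : \bar R :=
  'N[leb01sq]_2%:E[EFin \o k]%E.

Definition V : set (R -> R) := [set f | L2 f /\ \int[leb01]_x f x = 0].

Definition Vker : set (R * R -> R) :=
  [set k | L2ker k /\ {ae leb01, forall y, \int[leb01]_x k (x, y) = 0}].

Definition stochastic_kernel (k : R * R -> R) : Prop :=
  {ae leb01sq, forall p, 0 <= k p} /\
  {ae leb01, forall y, \int[leb01]_x k (x, y) = 1}.

Definition integral_operator (k : R * R -> R) (f : R -> R) : R -> R :=
  fun x => \int[leb01]_y (k (x, y) * f y).

Definition integral_preserving (L : (R -> R) -> R -> R) : Prop :=
  forall g, L2 g -> \int[leb01]_x L g x = \int[leb01]_x g x.

Definition convergence_to_equilibrium (L : (R -> R) -> R -> R) : Prop :=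
  forall g, V g -> L2norm (iter n L g) @[n --> \oo] --> 0%E.

(* S represents the bounded inverse of Id - L on V. Since S is bounded and L
   is linear, the last two clauses make S compatible with almost everywhere
   equality, linear, and unique up to almost everywhere equality. *)
Definition bounded_inverse_on_V (L S : (R -> R) -> R -> R) : Prop :=
  [/\ forall g, V g -> V (S g),
      exists C : R, forall g, V g -> (L2norm (S g) <= C%:E * L2norm g)%E,
      forall g, V g -> (S g \- L (S g)) = g %[ae leb01] &
      forall g, V g -> S (g \- L g) = g %[ae leb01]].

Definition normalized_invariant (L : (R -> R) -> R -> R) (f : R -> R) : Prop :=
  [/\ L2 f, \int[leb01]_x f x = 1 & L f = f %[ae leb01]].

End Spaces.

(* Main.v *)
(* Write L for the operator with kernel k_0 and T for the one with kernel k_0 - 1.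
   On mean zero functions T = L, and for an integral-preserving operator the
   normalized invariant functions are exactly the solutions of f - T f = 1.
   Almost every column of k_0 - 1 has mean zero, so by (A1) the iterates of T on
   it tend to 0; a truncation and dominated convergence upgrade this to
   ||T^N|| <= 1/2 for some N. Banach's fixed point theorem then inverts Id - T,
   and Id - T_delta for small delta by perturbation, so f_delta exists, is unique
   and is bounded uniformly in delta. The remainder
   w = (f_delta - f_0)/delta - (Id - L)^-1 (kdot f_0) satisfies
   (Id - T) w = kdot (f_delta - f_0) + delta^-1 r_delta f_delta, which tends to 0.
   All equations hold modulo functions of norm 0. *)
From HB Require Import structures.
Require Import Defs.
From mathcomp Require Import all_boot all_order all_algebra.
From mathcomp Require Import all_classical all_reals all_analysis.
From mathcomp Require Import measurable_realfun ring lra.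
Import Order.TTheory GRing.Theory Num.Theory.
Import numFieldNormedType.Exports.
Local Open Scope classical_set_scope.
Local Open Scope ring_scope.

Set Implicit Arguments.
Unset Strict Implicit.
Unset Printing Implicit Defensive.

(** Subtracting the kernel [1] turns [op K f] into [op K f] minus the mean of [f]. For a mean
    preserving [K] the result always has mean zero, so [Id - T] can be inverted on all of L^2
    without working in the subspace [V]. The obstacle is that (A1) is pointwise and has no rate,
    whereas inversion needs one power of [T] that is small in operator norm. The kernel bridges the
    gap: the kernel of [T^(n+1)] arises by applying [T^n] to each column of the kernel of [T], so
    its squared Hilbert-Schmidt norm is an integral over [y] of squared column norms that tend to 0
    for almost every [y]. No bound on the powers uniform in [n] is at hand to dominate these
    integrands, whence the truncation. Invertibility is kept as two facts, solvability and a lower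
    bound; the lower bound gives uniqueness and controls solutions picked by choice, and both facts
    survive small perturbations. Since operators on representatives are linear only up to functions
    of norm 0, the fixed point arguments are phrased for Lipschitz maps. *)

(* [fine] sends an infinite norm to 0: [nrm2] is only meaningful on [Lfun mu 2]. *)
Definition nrm2 d (T : measurableType d) (R : realType)
  (mu : {measure set T -> \bar R}) (f : T -> R) : R :=
  fine ('N[mu]_2%:E[EFin \o f])%E.

(** * Square integrable functions *)
Section square_integrable.
Context d (T : measurableType d) (R : realType).
Variable mu : {measure set T -> \bar R}.
Implicit Types f g : T -> R.
Local Notation L2 := (Lfun mu 2%:E).
Local Notation nrm := (nrm2 mu).

Lemma Lfun2_measurable f : f \in L2 -> measurable_fun setT f.
Proof. by rewrite inE => /andP[]; rewrite inE. Qed.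

Lemma nrm2K f : f \in L2 -> (nrm f)%:E = ('N[mu]_2%:E[EFin \o f])%E.
Proof.
rewrite inE => /andP[_]; rewrite inE/= /finite_norm => fy.
by rewrite /nrm2 fineK// ge0_fin_numE// Lnorm_ge0.
Qed.

Lemma nrm2_ge0 f : 0 <= nrm f.
Proof. by rewrite fine_ge0// Lnorm_ge0. Qed.

Lemma Lnorm2_sqr f :
  ('N[mu]_2%:E[EFin \o f] `^ 2 = \int[mu]_x (f x ^+ 2)%:E)%E.
Proof.
rewrite poweR_Lnorm//; apply: eq_integral => x _ /=.
by rewrite powR_mulrn// real_normK// num_real.
Qed.

Lemma nrm2_sqr f : f \in L2 -> (\int[mu]_x (f x ^+ 2)%:E = (nrm f ^+ 2)%:E)%E.
Proof.
by move=> fL; rewrite -Lnorm2_sqr -nrm2K//= powR_mulrn// nrm2_ge0.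
Qed.

Lemma Lfun2P f : f \in L2 <->
  measurable_fun setT f /\ (\int[mu]_x (f x ^+ 2)%:E < +oo)%E.
Proof.
split=> [fL|[mf fy]].
  by split; [exact: Lfun2_measurable|rewrite nrm2_sqr// ltry].
rewrite inE; apply/andP; split; rewrite inE//= /finite_norm.
by rewrite (@lty_poweRy _ _ 2)// Lnorm2_sqr.
Qed.

Lemma nrm2_le f c : measurable_fun setT f -> 0 <= c ->
  (\int[mu]_x (f x ^+ 2)%:E <= (c ^+ 2)%:E)%E -> f \in L2 /\ nrm f <= c.
Proof.
move=> mf c0 fc; have fL : f \in L2.
  by apply/Lfun2P; split=> //; rewrite (le_lt_trans fc)// ltry.
split=> //; move: fc; rewrite nrm2_sqr// lee_fin.
by rewrite ler_pXn2r// nnegrE// nrm2_ge0.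
Qed.

(** Only measurability is asked, so that the inequality applies to every section of a kernel and not
    just to almost every one. If the integral on the left is infinite, the real-valued integral is 0
    by default; if a norm is infinite, the extended right-hand side takes care of it. *)
Lemma Cauchy_Schwarz f g : measurable_fun setT f -> measurable_fun setT g ->
  (((\int[mu]_x (f x * g x)) ^+ 2)%:E <=
   (\int[mu]_x (f x ^+ 2)%:E) * (\int[mu]_x (g x ^+ 2)%:E))%E.
Proof.
move=> mf mg; rewrite -!Lnorm2_sqr -poweRM ?Lnorm_ge0//.
have -> : ((\int[mu]_x (f x * g x)) ^+ 2)%:E =
          ((`|\int[mu]_x (f x * g x)|)%:E `^ 2)%E.
  by rewrite poweR_EFin powR_mulrn// real_normK// num_real.
apply: gt0_ler_poweR; rewrite ?in_itv/= ?leey ?andbT ?lee_fin//.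
  by rewrite mule_ge0 ?Lnorm_ge0.
apply: le_trans (@hoelder _ _ _ mu f g 2 2 _ _ _ _ _) => //; last first.
  by rewrite [RHS]splitr !div1r.
rewrite Lnorm1 /Rintegral.
apply: le_trans (le_abse_integral _ _ _) => //.
  by case: (integral _ _ _) => [r||] /=; rewrite ?normr0 ?leey.
by apply/measurable_EFinP; exact: measurable_funM.
Qed.

Lemma Cauchy_Schwarz_L2 f g : f \in L2 -> g \in L2 ->
  `|\int[mu]_x (f x * g x)| <= nrm f * nrm g.
Proof.
move=> fL gL; have := Cauchy_Schwarz (Lfun2_measurable fL) (Lfun2_measurable gL).
rewrite !nrm2_sqr// -EFinM lee_fin -exprMn -real_normK ?num_real//.
by rewrite ler_pXn2r// nnegrE// mulr_ge0// nrm2_ge0.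
Qed.

Lemma Lfun2_integrableM f g : f \in L2 -> g \in L2 ->
  mu.-integrable setT (EFin \o (fun x => f x * g x)).
Proof. by move=> fL gL; apply/Lfun1_integrable; exact: Lfun2_mul_Lfun1. Qed.

Lemma Lfun2Z c f : f \in L2 -> (fun x => c * f x) \in L2.
Proof.
move=> fL; rewrite (_ : (fun _ => _) = c \o* f).
  by apply: Lfun_scale; rewrite ?ler1n.
by apply/funext => x /=; rewrite mulrC.
Qed.

Lemma nrm2Z c f : f \in L2 -> nrm (fun x => c * f x) = `|c| * nrm f.
Proof.
move=> fL; apply/eqP; rewrite -(@eqrXn2 _ 2)// ?nrm2_ge0//; last first.
  by rewrite mulr_ge0// nrm2_ge0.
rewrite -eqe -nrm2_sqr; last exact: Lfun2Z.
rewrite exprMn EFinM -nrm2_sqr// real_normK ?num_real//; apply/eqP.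
under eq_integral do rewrite exprMn EFinM.
rewrite ge0_integralZl ?lee_fin ?sqr_ge0//.
- by apply/measurable_EFinP/measurable_funX; exact: Lfun2_measurable.
- by move=> x _; rewrite lee_fin sqr_ge0.
Qed.

Lemma Lfun2_nrm2D f g : f \in L2 -> g \in L2 ->
  f \+ g \in L2 /\ nrm (f \+ g) <= nrm f + nrm g.
Proof.
move=> fL gL; have mf := Lfun2_measurable fL; have mg := Lfun2_measurable gL.
have := minkowski mu mf mg (_ : 1 <= 2); rewrite ler1n => /(_ isT).
rewrite -(nrm2K fL) -(nrm2K gL) -EFinD => fg.
have fgL : f \+ g \in L2.
  rewrite inE; apply/andP; split; rewrite inE/=; first exact: measurable_funD.
  by rewrite /finite_norm (le_lt_trans fg)// ltry.
by split=> //; rewrite -nrm2K// in fg; rewrite -lee_fin.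
Qed.

Lemma Lfun2D f g : f \in L2 -> g \in L2 -> f \+ g \in L2.
Proof. by move=> fL /(Lfun2_nrm2D fL)[]. Qed.

Lemma nrm2D f g : f \in L2 -> g \in L2 -> nrm (f \+ g) <= nrm f + nrm g.
Proof. by move=> fL /(Lfun2_nrm2D fL)[]. Qed.

Let subE f g : f \- g = f \+ (fun x => (-1) * g x).
Proof. by apply/funext => x /=; rewrite mulN1r. Qed.

Lemma Lfun2B f g : f \in L2 -> g \in L2 -> f \- g \in L2.
Proof. by move=> fL gL; rewrite subE; apply: Lfun2D => //; exact: Lfun2Z. Qed.

Lemma nrm2B f g : f \in L2 -> g \in L2 -> nrm (f \- g) <= nrm f + nrm g.
Proof.
move=> fL gL; rewrite subE (le_trans (nrm2D _ _))// ?Lfun2Z//.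
by rewrite nrm2Z// normrN1 mul1r.
Qed.

Lemma nrm2BC f g : nrm (f \- g) = nrm (g \- f).
Proof.
congr fine; rewrite -oppe_Lnorm; congr Lnorm; apply/funext => x /=.
by rewrite opprB.
Qed.

Lemma nrm2_triangle f g h : f \in L2 -> g \in L2 -> h \in L2 ->
  nrm (f \- g) <= nrm (f \- h) + nrm (h \- g).
Proof.
move=> fL gL hL; rewrite (_ : f \- g = (f \- h) \+ (h \- g)).
  by apply: nrm2D; exact: Lfun2B.
by apply/funext => x /=; rewrite addrA subrK.
Qed.

Lemma ler_nrm2 f g : f \in L2 -> g \in L2 -> nrm f <= nrm (f \- g) + nrm g.
Proof.
move=> fL gL; rewrite {1}(_ : f = (f \- g) \+ g).
  by apply: nrm2D => //; exact: Lfun2B.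
by apply/funext => x /=; rewrite subrK.
Qed.

Lemma Lfun2_ae_eq f g : f \in L2 -> measurable_fun setT g ->
  f = g %[ae mu] -> g \in L2 /\ nrm g = nrm f.
Proof.
move=> fL mg fg; have mf := Lfun2_measurable fL.
have E : (\int[mu]_x (g x ^+ 2)%:E = \int[mu]_x (f x ^+ 2)%:E)%E.
  apply: ae_eq_integral => //.
  - by apply/measurable_EFinP/measurable_funX.
  - by apply/measurable_EFinP/measurable_funX.
  - by apply: filterS fg => x fg ?; rewrite fg.
have gL : g \in L2 by apply/Lfun2P; rewrite E; split=> //; case/Lfun2P: fL.
split=> //; apply/eqP; rewrite -(@eqrXn2 _ 2)// ?nrm2_ge0//.
by rewrite -eqe -!nrm2_sqr// E.
Qed.

Lemma nrm2_eq0 f : f \in L2 -> nrm f = 0 -> f = cst 0 %[ae mu].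
Proof.
move=> fL f0; have mf := Lfun2_measurable fL.
have : ('N[mu]_2%:E[EFin \o f] = 0)%E by rewrite -nrm2K// f0.
move/Lnorm_eq0_eq0 => /(_ _ _)/wrap[]; first exact/measurable_EFinP.
  by rewrite lte_fin ltr0n.
by apply: filterS => x /= /(_ I) [].
Qed.

(** Bridge between the two equalities in use: distance 0 in norm, in which operator estimates are
    chained, and almost everywhere equality, in which pointwise identities are computed. *)
Lemma nrm2B_eq0 f g : f \in L2 -> g \in L2 ->
  nrm (f \- g) = 0 <-> f = g %[ae mu].
Proof.
move=> fL gL; split=> [/nrm2_eq0|fg].
  move=> /(_ (Lfun2B fL gL)); apply: filterS => x /= /(_ I).
  by move/eqP; rewrite subr_eq0 => /eqP.
have f0 : (f \- g) = (fun x => 0 * f x) %[ae mu].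
  by apply: filterS fg => x /= /(_ I) -> _; rewrite subrr mul0r.
have [|_ <-] := Lfun2_ae_eq (Lfun2B fL gL) _ f0.
  by apply: Lfun2_measurable; exact: Lfun2Z.
by rewrite nrm2Z// normr0 mul0r.
Qed.

End square_integrable.

(** * Completeness of the space of square integrable functions *)

Lemma cvg_sqr (R : realType) (u : nat -> R) (l : R) :
  u @ \oo --> l -> (fun n => u n ^+ 2) @ \oo --> l ^+ 2.
Proof. by move=> ul; under eq_fun do rewrite expr2; rewrite expr2; exact: cvgM. Qed.

Lemma cvg_sqr0 (R : realType) (u : nat -> R) : (forall n, 0 <= u n) ->
  (fun n => (u n ^+ 2)%:E) @ \oo --> 0%E -> u @ \oo --> (0 : R).
Proof.
move=> u0 /fine_cvgP[_] /=.
rewrite (_ : fine \o _ = fun n => u n ^+ 2)// => uu.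
have -> : u = (fun n => Num.sqrt (u n ^+ 2)).
  by apply/funext => n; rewrite sqrtr_sqr ger0_norm.
by rewrite -[X in _ --> X]sqrtr0; apply: continuous_cvg => //; exact: sqrt_continuous.
Qed.

Section completeness.
Context d (T : measurableType d) (R : realType).
Variable mu : {measure set T -> \bar R}.
Local Notation L2 := (Lfun mu 2%:E).
Local Notation nrm := (nrm2 mu).

Lemma Lfun2_sum (u : nat -> T -> R) n : (forall i, u i \in L2) ->
  (fun x => \sum_(0 <= i < n) u i x) \in L2 /\
  nrm (fun x => \sum_(0 <= i < n) u i x) <= \sum_(0 <= i < n) nrm (u i).
Proof.
move=> uL; elim: n => [|n [IH IHn]].
  rewrite big_nil (_ : (fun _ => _) = fun x => 0 * u 0 x); last first.
    by apply/funext => x; rewrite big_nil mul0r.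
  by rewrite nrm2Z// normr0 mul0r; split=> //; exact: Lfun2Z.
rewrite (_ : (fun _ => _) = (fun x => \sum_(0 <= i < n) u i x) \+ u n); last first.
  by apply/funext => x; rewrite big_nat_recr.
split; first exact: Lfun2D.
by rewrite (le_trans (nrm2D _ _))// big_nat_recr//= lerD.
Qed.

Lemma Lfun2_abs (f : T -> R) : f \in L2 ->
  (fun x => `|f x|) \in L2 /\ nrm (fun x => `|f x|) = nrm f.
Proof.
move=> fL; have mf := Lfun2_measurable fL.
have maf : measurable_fun setT (fun x => `|f x|) by exact: measurableT_comp.
have E : (\int[mu]_x (`|f x| ^+ 2)%:E = \int[mu]_x (f x ^+ 2)%:E)%E.
  by apply: eq_integral => x _; rewrite real_normK ?num_real.
have aL : (fun x => `|f x|) \in L2.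
  by apply/Lfun2P; rewrite E; split=> //; case/Lfun2P : fL.
split=> //; apply/eqP; rewrite -(@eqrXn2 _ 2)// ?nrm2_ge0//.
by rewrite -eqe -!nrm2_sqr// E.
Qed.

(** Riesz-Fischer in series form. Monotone convergence bounds the integral of [Gs], the limit of the
    squared partial sums of absolute values, by [B ^+ 2]; hence [Gs] is finite almost everywhere,
    the series converges there, and a multiple of [Gs] dominates the squared remainders. *)
Lemma Lfun2_complete (u : nat -> T -> R) (B : R) : (forall i, u i \in L2) ->
  (forall n, \sum_(0 <= i < n) nrm (u i) <= B) ->
  exists2 h, h \in L2 &
    (fun n => nrm (h \- (fun x => \sum_(0 <= i < n) u i x))) @ \oo --> (0 : R).
Proof.
move=> uL uB; have mu_ i := Lfun2_measurable (uL i).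
pose G n x := \sum_(0 <= i < n) `|u i x|.
have mG n : measurable_fun setT (G n).
  by apply: measurable_sum => i; exact: measurableT_comp.
have G0 n x : 0 <= G n x by apply: sumr_ge0.
have Gnd x m n : (m <= n)%N -> G m x <= G n x.
  by move=> mn; apply: (@nondecreasing_series _ (fun i => `|u i x|) xpredT 0).
have B0 : 0 <= B by have := uB 0%N; rewrite big_nil.
have GB n : (\int[mu]_x (G n x ^+ 2)%:E <= (B ^+ 2)%:E)%E.
  have [GL Gle] := Lfun2_sum n (fun i => (Lfun2_abs (uL i)).1).
  rewrite nrm2_sqr// lee_fin ler_pXn2r// ?nnegrE ?nrm2_ge0//.
  rewrite (le_trans Gle)// (le_trans _ (uB n))// ler_sum// => i _.
  by rewrite (Lfun2_abs (uL i)).2.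
have mG2 n : measurable_fun setT (fun x => (G n x ^+ 2)%:E).
  by apply/measurable_EFinP; exact: measurable_funX.
have G2nd x : {homo (fun n => (G n x ^+ 2)%:E) : m n / (m <= n)%N >-> (m <= n)%E}.
  by move=> m n mn; rewrite lee_fin ler_pXn2r// ?nnegrE//; exact: Gnd.
pose Gs x := limn (fun n => (G n x ^+ 2)%:E).
have cG x : (fun n => (G n x ^+ 2)%:E) @ \oo --> Gs x.
  exact: ereal_nondecreasing_is_cvgn.
have G2le n x : ((G n x ^+ 2)%:E <= Gs x)%E.
  rewrite /Gs (cvg_lim _ (ereal_nondecreasing_cvgn (G2nd x)))//.
  by apply: ereal_sup_ubound; exists n.
have mGs : measurable_fun setT Gs by exact: (emeasurable_fun_cvg _ _ mG2).
have Gs0 x : (0 <= Gs x)%E by rewrite (le_trans _ (G2le 0%N x))// lee_fin sqr_ge0.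
have GsB : (\int[mu]_x Gs x <= (B ^+ 2)%:E)%E.
  rewrite monotone_convergence//; last by move=> n x _; rewrite lee_fin sqr_ge0.
  apply: lime_le; last by apply: nearW.
  apply: ereal_nondecreasing_is_cvgn => m n mn.
  apply: ge0_le_integral => //; first by move=> x _; rewrite lee_fin sqr_ge0.
  by move=> x _; exact: G2nd.
have iGs : mu.-integrable setT Gs.
  apply/integrableP; split=> //; under eq_integral do rewrite gee0_abs//.
  by rewrite (le_lt_trans GsB)// ltry.
(* Zeroing the terms where [Gs] is infinite makes the series converge at every point, so that its
   limit [h] is measurable. *)
pose w i x := if (Gs x < +oo)%E then u i x else 0.
have mw i : measurable_fun setT (w i).
  by apply: measurable_fun_ifT => //; apply: measurable_fun_lte.
have cw x : cvgn (series (fun i => w i x)).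
  apply: normed_cvg; apply: nondecreasing_is_cvgn.
    by apply: nondecreasing_series => i _ _; exact: normr_ge0.
  have [Gsx|Gsx] := ltP (Gs x) +oo%E; last first.
    exists 0 => _ [n _ <-]; apply: (@le_trans _ _ (\sum_(0 <= i < n) `|w i x|)) => //.
    by rewrite big1// => i _; rewrite /w ltNge Gsx normr0.
  have fGs : Gs x \is a fin_num by rewrite ge0_fin_numE.
  (* [Gs] bounds the squares of the partial sums; the inequality [t <= t ^+ 2 + 1] turns this into a
     bound on the sums themselves. *)
  exists (fine (Gs x) + 1) => _ [n _ <-].
  have := G2le n x; rewrite -{1}(fineK fGs) lee_fin => Gn.
  rewrite /series/= [leLHS](_ : _ = G n x); last first.
    by apply: eq_bigr => i _; rewrite /w Gsx.
  have := sqr_ge0 (G n x - 1); rewrite sqrrB1 => Gn1.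
  by have := G0 n x; nra.
pose h x := limn (series (fun i => w i x)).
have mh : measurable_fun setT h.
  apply: (@measurable_fun_cvg _ _ _ _ (fun n x => series (fun i => w i x) n)).
    by move=> n; apply: measurable_sum.
  by move=> x _; exact: cw.
pose s n x := \sum_(0 <= i < n) u i x.
have ms n : measurable_fun setT (s n) by apply: measurable_sum.
have fin_ae : {ae mu, forall x, (Gs x < +oo)%E}.
  have := integrable_ae measurableT iGs; apply: filterS => x /(_ I).
  by rewrite ge0_fin_numE.
have sh : {ae mu, forall x, (fun n => s n x) @ \oo --> h x}.
  apply: filterS fin_ae => x Gx; rewrite (_ : (fun n => s n x) = series (fun i => w i x)).
    exact: cw.
  by apply/funext => n; apply: eq_bigr => i _; rewrite /w Gx.
have sG n x : s n x ^+ 2 <= G n x ^+ 2.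
  rewrite -[s n x ^+ 2]real_normK ?num_real//.
  by rewrite ler_pXn2r ?nnegrE//; exact: ler_norm_sum.
(* The factor 4 comes from [(a - b) ^+ 2 <= 2 * a ^+ 2 + 2 * b ^+ 2] applied to two partial sums,
   the first of which is then sent to its limit. *)
have dom : {ae mu, forall x n, setT x -> (`|((h x - s n x) ^+ 2)%:E| <= 4%:E * Gs x)%E}.
  apply: filterS2 fin_ae sh => x Gx shx n _.
  have fGs : Gs x \is a fin_num by rewrite ge0_fin_numE.
  rewrite -(fineK fGs) -EFinM lee_fin ger0_norm ?sqr_ge0//.
  have sle m : s m x ^+ 2 <= fine (Gs x).
    by rewrite (le_trans (sG m x))// -lee_fin fineK.
  apply: (@cvgr_to_le _ \oo _ _ (fun m => (s m x - s n x) ^+ 2)).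
    by apply: cvg_sqr; apply: cvgB => //; exact: cvg_cst.
  apply: nearW => m; have := sle m; have := sle n.
  by have := sqr_ge0 (s m x + s n x); nra.
have [|||||_ _] := @dominated_convergence _ _ _ mu _ measurableT
    (fun n x => ((h x - s n x) ^+ 2)%:E) (cst 0%E) (fun x => 4%:E * Gs x)%E.
- by move=> n; apply/measurable_EFinP/measurable_funX; exact: measurable_funB.
- exact: measurable_cst.
- apply: filterS sh => x shx _; apply: cvg_EFin; first exact: nearW.
  rewrite (_ : fine \o _ = fun n => (h x - s n x) ^+ 2)//.
  rewrite (_ : 0 = (h x - h x) ^+ 2); last by rewrite subrr expr0n.
  by apply: cvg_sqr; apply: cvgB => //; exact: cvg_cst.
- exact: integrableZl.
- exact: dom.
rewrite integral_cst// mul0e => hs.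
have hsL n : h \- s n \in L2.
  apply/Lfun2P; split; first exact: measurable_funB.
  apply: (@le_lt_trans _ _ (\int[mu]_x (4%:E * Gs x))%E).
    apply: ae_ge0_le_integral => //.
    - by move=> x _; rewrite lee_fin sqr_ge0.
    - by apply/measurable_EFinP/measurable_funX; exact: measurable_funB.
    - by move=> x _; rewrite mule_ge0// lee_fin.
    - exact: measurable_funeM.
    - apply: filterS dom => x /(_ n I); rewrite gee0_abs ?lee_fin ?sqr_ge0//.
  by rewrite ge0_integralZl// lte_mul_pinfty// (le_lt_trans GsB)// ltry.
exists h.
  (* The empty partial sum is 0, so membership of [h] is the case 0 of [hsL]. *)
  rewrite (_ : h = h \- s 0%N)//.
  by apply/funext => x /=; rewrite /s big_nil subr0.
apply: cvg_sqr0 => [n|]; first exact: nrm2_ge0.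
rewrite (_ : (fun n => _) = fun n => (\int[mu]_x ((h x - s n x) ^+ 2)%:E)%E)//.
by apply/funext => n; rewrite -nrm2_sqr//; exact: hsL.
Qed.

End completeness.

(** * Lipschitz and bounded operators on square integrable functions *)
Section operators.
Context d (T : measurableType d) (R : realType).
Variable mu : {measure set T -> \bar R}.
Local Notation L2 := (Lfun mu 2%:E).
Local Notation nrm := (nrm2 mu).
Implicit Types (A E F : (T -> R) -> T -> R) (f g h : T -> R).

Definition stable_L2 A := forall f, f \in L2 -> A f \in L2.

(** Phrased on differences because it is also applied to affine maps and to a choice of solutions,
    which are not linear. *)
Definition lipschitz_L2 A c := forall f g, f \in L2 -> g \in L2 ->
  nrm (A f \- A g) <= c * nrm (f \- g).

(** Linearity enters as compatibility with differences, up to norm 0: for a kernel operator it is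
    established only at points whose section of the kernel is square integrable. *)
Definition bounded_linear_L2 A c :=
  [/\ stable_L2 A,
      forall f g, f \in L2 -> g \in L2 ->
        nrm (A (f \- g) \- (A f \- A g)) = 0 &
      forall f, f \in L2 -> nrm (A f) <= c * nrm f].

(* [Id - A] is onto and bounded below, up to functions of norm 0. *)
Definition invertible_sub1 A C :=
  (forall g, g \in L2 -> exists2 h, h \in L2 & nrm ((h \- A h) \- g) = 0) /\
  (forall h, h \in L2 -> nrm h <= C * nrm (h \- A h)).

Lemma nrm2_le_eq f g : f \in L2 -> g \in L2 -> nrm (f \- g) = 0 -> nrm f <= nrm g.
Proof. by move=> fL gL fg; rewrite (le_trans (ler_nrm2 fL gL))// fg add0r. Qed.

Lemma nrm2_eq f g : f \in L2 -> g \in L2 -> nrm (f \- g) = 0 -> nrm f = nrm g.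
Proof.
move=> fL gL fg; apply/eqP; rewrite eq_le !nrm2_le_eq//.
by rewrite nrm2BC.
Qed.

Lemma bounded_linear_lipschitz A c : bounded_linear_L2 A c -> lipschitz_L2 A c.
Proof.
move=> [AL AB Ac] f g fL gL; rewrite -(nrm2_eq _ _ (AB f g fL gL)).
- by apply: Ac; exact: Lfun2B.
- by apply: AL; exact: Lfun2B.
- by apply: Lfun2B; exact: AL.
Qed.

Lemma nrm2_dist0_trans f g h : f \in L2 -> g \in L2 -> h \in L2 ->
  nrm (f \- g) = 0 -> nrm (g \- h) = 0 -> nrm (f \- h) = 0.
Proof.
move=> fL gL hL fg gh; apply/eqP; rewrite eq_le nrm2_ge0 andbT.
by rewrite (le_trans (nrm2_triangle fL hL gL))// fg gh addr0.
Qed.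

Lemma stable_L2_iter A n : stable_L2 A -> stable_L2 (iter n A).
Proof. by move=> AL f fL; elim: n => //= n IH; exact: AL. Qed.

Lemma invertible_sub1_inj A a C f g b : bounded_linear_L2 A a ->
  invertible_sub1 A C -> f \in L2 -> g \in L2 -> b \in L2 ->
  nrm ((f \- A f) \- b) = 0 -> nrm ((g \- A g) \- b) = 0 -> nrm (f \- g) = 0.
Proof.
move=> [AL AB _] [_ low] fL gL bL fb gb; have fgL := Lfun2B fL gL.
have DL h : h \in L2 -> h \- A h \in L2 by move=> hL; apply: Lfun2B => //; exact: AL.
apply/eqP; rewrite eq_le nrm2_ge0 andbT (le_trans (low _ fgL))//.
suff -> : nrm ((f \- g) \- A (f \- g)) = 0 by rewrite mulr0.
have gb' : nrm (b \- (g \- A g)) = 0 by rewrite nrm2BC.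
rewrite -(nrm2_dist0_trans (DL _ fL) bL (DL _ gL) fb gb').
apply: nrm2_eq; first exact: DL.
  by apply: Lfun2B; exact: DL.
rewrite -(AB _ _ fL gL) nrm2BC; congr nrm.
by apply/funext => x /=; ring.
Qed.

Lemma lipschitz_iter A c n : 0 <= c -> stable_L2 A -> lipschitz_L2 A c ->
  lipschitz_L2 (iter n A) (c ^+ n).
Proof.
move=> c0 AL Ac f g fL gL; elim: n => [|n IH]/=; first by rewrite expr0 mul1r.
have := Ac _ _ (stable_L2_iter n AL fL) (stable_L2_iter n AL gL).
by move=> /le_trans; apply; rewrite exprS -mulrA ler_wpM2l.
Qed.

Lemma Banach_fixpoint F c : 0 <= c -> c < 1 ->
  stable_L2 F -> lipschitz_L2 F c ->
  forall f0, f0 \in L2 -> exists2 h, h \in L2 & nrm (F h \- h) = 0.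
Proof.
move=> c0 c1 FL Fc f0 f0L.
pose s n := iter n F f0; have sL n : s n \in L2 by exact: stable_L2_iter.
pose u n := s n.+1 \- s n.
have uL n : u n \in L2 by exact: Lfun2B.
have u_le n : nrm (u n) <= c ^+ n * nrm (u 0).
  rewrite /u /s -[X in iter X]addn1 iterD /=.
  by apply: (@lipschitz_iter F c n) => //; exact: FL.
have usum n : \sum_(0 <= i < n) nrm (u i) <= nrm (u 0) / (1 - c).
  apply: (@le_trans _ _ (\sum_(0 <= i < n) c ^+ i * nrm (u 0))).
    by apply: ler_sum => i _.
  rewrite -mulr_suml mulrC ler_wpM2l ?nrm2_ge0//.
  rewrite -[leRHS]mul1r ler_pdivlMr ?subr_gt0// mulrC.
  have -> : (1 - c) * \sum_(0 <= i < n) c ^+ i = 1 - c ^+ n.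
    by rewrite big_mkord -[RHS]opprB subrX1 -mulNr opprB.
  by rewrite gerBl exprn_ge0.
have [h0 h0L h0s] := Lfun2_complete uL usum.
(* [h0] sums the increments of the orbit, so the orbit itself converges to [h0] plus its starting
   point. *)
pose h := h0 \+ f0; have hL : h \in L2 by exact: Lfun2D.
have hs : (fun n => nrm (h \- s n)) @ \oo --> (0 : R).
  apply: cvg_trans h0s; apply: near_eq_cvg; apply: nearW => n; congr nrm.
  apply/funext => x /=; rewrite /h /= /u /= telescope_sumr//.
  by rewrite /s /=; ring.
exists h => //; apply/eqP; rewrite eq_le nrm2_ge0 andbT.
have hs1 : (fun n => nrm (h \- s n.+1)) @ \oo --> (0 : R).
  by move: hs; rewrite -(cvg_shiftS (fun n => nrm (h \- s n))).
have lim0 : (fun n => c * nrm (h \- s n) + nrm (h \- s n.+1)) @ \oo --> (0 : R).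
  rewrite -[X in _ --> X](addr0 0) -{1}(mulr0 c).
  by apply: cvgD => //; apply: cvgM => //; exact: cvg_cst.
apply: (cvgr_to_ge lim0); apply: nearW => n.
apply: le_trans (nrm2_triangle (FL _ hL) hL (sL n.+1)) _.
by rewrite [nrm (s n.+1 \- h)]nrm2BC lerD// Fc.
Qed.

(** If [h] is fixed by the [N]-th iterate, so is [F h], and the contraction forces the two to
    coincide. The Lipschitz bound [a], of any size, ensures that [F] respects equality up to norm
    0. *)
Lemma Banach_fixpoint_iter F a c N : 0 <= a -> 0 <= c -> c < 1 ->
  stable_L2 F -> lipschitz_L2 F a -> lipschitz_L2 (iter N F) c ->
  forall f0, f0 \in L2 -> exists2 h, h \in L2 & nrm (F h \- h) = 0.
Proof.
move=> a0 c0 c1 FL Fa FNc f0 f0L; have FNL := stable_L2_iter N FL.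
have [h hL hF] := Banach_fixpoint c0 c1 FNL FNc f0L.
exists h => //; apply/eqP; rewrite eq_le nrm2_ge0 andbT.
have FhL := FL _ hL.
have /eqP : nrm (F (iter N F h) \- F h) = 0.
  apply/eqP; rewrite eq_le nrm2_ge0 andbT.
  by rewrite (le_trans (Fa _ _ (FNL _ hL) hL))// hF mulr0.
rewrite -iterS iterSr => /eqP FFh.
have h1 : nrm (F h \- h) <= nrm (iter N F (F h) \- iter N F h).
  apply: le_trans (nrm2_triangle FhL hL (FNL _ hL)) _.
  rewrite hF addr0.
  apply: le_trans (nrm2_triangle FhL (FNL _ hL) (FNL _ FhL)) _.
  by rewrite nrm2BC FFh add0r.
have := le_trans h1 (FNc _ _ FhL hL).
by have := nrm2_ge0 mu (F h \- h); nra.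
Qed.

Let resolvent_map A g := fun h => A h \+ g.

(** Solutions of [h - A h = g] are the fixed points of [h |-> A h + g], whose [N]-th iterate
    contracts because that of [A] does. The lower bound comes from telescoping [h - A^N h]. *)
Lemma invertible_power A a c N : 0 <= a -> 0 <= c -> c < 1 ->
  bounded_linear_L2 A a -> (forall f, f \in L2 -> nrm (iter N A f) <= c * nrm f) ->
  exists C, 0 <= C /\ invertible_sub1 A C.
Proof.
move=> a0 c0 c1 Aa AN; have [AL AB _] := Aa.
have Alip := bounded_linear_lipschitz Aa.
have AiL n := stable_L2_iter n AL.
have surj : forall g, g \in L2 -> exists2 h, h \in L2 & nrm ((h \- A h) \- g) = 0.
  move=> g gL; pose F := resolvent_map A g.
  have FL : stable_L2 F by move=> f fL; apply: Lfun2D => //; exact: AL.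
  have FB f f' : F f \- F f' = A f \- A f'.
    by apply/funext => x; rewrite /F/resolvent_map /= opprD addrACA subrr addr0.
  have Fa : lipschitz_L2 F a by move=> f f' fL f'L; rewrite FB; exact: Alip.
  have FiL n := stable_L2_iter n FL.
  (* The constant term [g] cancels in differences, so iterates of the affine map differ by an
     iterate of its linear part. *)
  have FN n f f' : f \in L2 -> f' \in L2 ->
      nrm ((iter n F f \- iter n F f') \- iter n A (f \- f')) = 0.
    move=> fL f'L; have ffL := Lfun2B fL f'L.
    elim: n => /= [|n IH].
      by apply/(nrm2B_eq0 ffL ffL); exact: ae_eq_refl.
    rewrite FB; apply: (@nrm2_dist0_trans _ (A (iter n F f \- iter n F f'))).
    - by apply: Lfun2B; apply: AL; exact: FiL.
    - by apply: AL; apply: Lfun2B; exact: FiL.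
    - by apply: AL; exact: AiL.
    - by rewrite nrm2BC AB//; exact: FiL.
    - apply/eqP; rewrite eq_le nrm2_ge0 andbT.
      rewrite (le_trans (Alip _ _ _ _))// ?IH ?mulr0//; last exact: AiL.
      by apply: Lfun2B; exact: FiL.
  have FNc : lipschitz_L2 (iter N F) c.
    move=> f f' fL f'L; have ffL := Lfun2B fL f'L.
    rewrite (nrm2_eq _ _ (FN N f f' fL f'L)); [exact: AN| |exact: AiL].
    by apply: Lfun2B; exact: FiL.
  have [h hL hF] := Banach_fixpoint_iter a0 c0 c1 FL Fa FNc gL.
  exists h => //; rewrite -hF nrm2BC; congr nrm; apply/funext => x /=.
  by rewrite /F /resolvent_map /=; ring.
(* Passing from [n] to [n + 1] adds the norm of the [n]-th iterate applied to [h - A h], which costs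
   [a ^+ n]. *)
have lower n : exists2 C, 0 <= C & forall h, h \in L2 ->
    nrm h <= C * nrm (h \- A h) + nrm (iter n A h).
  elim: n => [|n [C C0 IH]].
    by exists 0 => // h hL; rewrite mul0r add0r.
  exists (C + a ^+ n) => [|h hL]; first by rewrite addr_ge0// exprn_ge0.
  apply: le_trans (IH _ hL) _; rewrite mulrDl -addrA lerD2l.
  apply: le_trans (ler_nrm2 (AiL n _ hL) (AiL n.+1 _ hL)) _.
  by rewrite lerD2r iterSr; exact: (@lipschitz_iter A a n a0 AL Alip h (A h) hL (AL _ hL)).
(* For [n = N] the last term is at most [c] times the norm of [h] and is absorbed on the left, which
   produces the division by [1 - c]. *)
have [C C0 CN] := lower N; exists (C / (1 - c)); split.
  by rewrite divr_ge0// subr_ge0 ltW.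
split=> // h hL; rewrite mulrAC ler_pdivlMr ?subr_gt0// mulrBr mulr1 lerBlDr.
by rewrite (le_trans (CN _ hL))// lerD2l mulrC AN.
Qed.

(** Neumann series argument for [A' = A + E], with the series replaced by a fixed point. In the
    lower bound the perturbation costs at most [C * e <= 2^-1] times the norm of [h]; absorbing this
    half doubles the constant. *)
Lemma invertible_perturbation A A' E a e C : 0 <= e -> 0 <= C -> C * e <= 2^-1 ->
  bounded_linear_L2 A a -> bounded_linear_L2 E e -> stable_L2 A' ->
  (forall f, f \in L2 -> nrm (A' f \- (A f \+ E f)) = 0) ->
  invertible_sub1 A C -> invertible_sub1 A' (2 * C).
Proof.
move=> e0 C0 Ce Aa Ee A'L A'E [surjA lowA].
have [AL AB _] := Aa; have [EL EB Ebnd] := Ee.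
have Elip := bounded_linear_lipschitz Ee.
have A'_dist h : h \in L2 -> nrm ((h \- A' h) \- ((h \- A h) \- E h)) = 0.
  move=> hL; rewrite -(A'E h hL) nrm2BC; congr nrm; apply/funext => x /=; ring.
have DL B h : stable_L2 B -> h \in L2 -> h \- B h \in L2.
  by move=> BL hL; apply: Lfun2B => //; exact: BL.
split=> [g gL|h hL].
  (* [S] is an arbitrary choice of solutions of [h - A h = f]; its Lipschitz constant [C] is
     recovered from the lower bound for [A]. *)
  have /choice[S SP] : forall f, exists h, f \in L2 ->
      h \in L2 /\ nrm ((h \- A h) \- f) = 0.
    move=> f; have [fL|fL] := boolP (f \in L2); last by exists f.
    by have [h hL hf] := surjA f fL; exists h.
  have SL f : f \in L2 -> S f \in L2 by move=> /SP[].
  have Slip : lipschitz_L2 S C.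
    move=> f f' fL f'L; have SfL := SL f fL; have Sf'L := SL f' f'L.
    have ffL := Lfun2B fL f'L; have SSL := Lfun2B SfL Sf'L.
    apply: le_trans (lowA _ SSL) _; rewrite ler_wpM2l//.
    apply: nrm2_le_eq => //; first exact: DL.
    pose D f := S f \- A (S f); have D_L k : k \in L2 -> D k \in L2.
      by move=> kL; apply: DL => //; exact: SL.
    apply: (@nrm2_dist0_trans _ (D f \- D f')) => //.
    - exact: DL.
    - by apply: Lfun2B; exact: D_L.
    - rewrite -(AB _ _ SfL Sf'L) nrm2BC; congr nrm; apply/funext => x /=.
      by rewrite /D /=; ring.
    - apply/eqP; rewrite eq_le nrm2_ge0 andbT.
      have -> : (D f \- D f') \- (f \- f') = (D f \- f) \- (D f' \- f').
        by apply/funext => x /=; ring.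
      apply: le_trans (nrm2B _ _) _; try by apply: Lfun2B => //; exact: D_L.
      by rewrite (SP f fL).2 (SP f' f'L).2 addr0.
  (* If [u] is a fixed point, then [h = S u] satisfies [h - A h = u = E h + g], which is the
     perturbed equation. *)
  pose F u := E (S u) \+ g.
  have FL : stable_L2 F.
    by move=> f fL; apply: Lfun2D => //; apply: EL; exact: SL.
  have Flip : lipschitz_L2 F 2^-1.
    move=> f f' fL f'L; rewrite (_ : F f \- F f' = E (S f) \- E (S f')); last first.
      by apply/funext => x; rewrite /F /=; ring.
    apply: le_trans (Elip _ _ (SL _ fL) (SL _ f'L)) _.
    apply: (@le_trans _ _ (e * (C * nrm (f \- f')))).
      by rewrite ler_wpM2l// Slip.
    by rewrite mulrA [e * C]mulrC ler_wpM2r// nrm2_ge0.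
  have [||u uL Fu] := Banach_fixpoint _ _ FL Flip gL; rewrite ?invr_ge0//.
    by rewrite invf_lt1// ltr1n.
  have SuL := SL u uL; exists (S u) => //.
  apply: (@nrm2_dist0_trans _ ((S u \- A (S u)) \- E (S u))) => //.
  - exact: DL.
  - by apply: Lfun2B; [exact: DL|exact: EL].
  - exact: A'_dist.
  apply/eqP; rewrite eq_le nrm2_ge0 andbT.
  have -> : ((S u \- A (S u)) \- E (S u)) \- g =
      ((S u \- A (S u)) \- u) \- (F u \- u).
    by apply/funext => x; rewrite /F /=; ring.
  apply: le_trans (nrm2B _ _) _.
  - by apply: Lfun2B => //; exact: DL.
  - by apply: Lfun2B => //; exact: FL.
  - by rewrite Fu (SP u uL).2 addr0.
have hAL := DL A h AL hL; have hA'L := DL A' h A'L hL; have EhL := EL h hL.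
have h1 : nrm (h \- A h) <= nrm (h \- A' h) + e * nrm h.
  apply: le_trans (ler_nrm2 hAL (Lfun2B hAL EhL)) _.
  rewrite -(nrm2_eq hA'L (Lfun2B hAL EhL) (A'_dist h hL)) addrC lerD2l.
  rewrite (_ : (h \- A h) \- ((h \- A h) \- E h) = E h); first exact: Ebnd.
  by apply/funext => x /=; ring.
have := le_trans (lowA h hL) (ler_wpM2l C0 h1).
have := ler_wpM2r (nrm2_ge0 mu h) Ce.
rewrite mulrDr mulrA -mulrA; lra.
Qed.

End operators.

Definition kernel_operator d (T : measurableType d) (R : realType)
    (mu : {measure set T -> \bar R}) (K : T * T -> R) (f : T -> R) : T -> R :=
  fun x => \int[mu]_y (K (x, y) * f y).

(** The kernel of the composite operator, written so that its column at [y] is by computation the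
    operator of [K] applied to the column of [H] at [y]. *)
Definition kernel_comp d (T : measurableType d) (R : realType)
    (mu : {measure set T -> \bar R}) (K H : T * T -> R) : T * T -> R :=
  fun p => kernel_operator mu K (fun z => H (z, p.2)) p.1.

(** * Integral operators with square integrable kernel *)
Section product_sections.
Context d (T : measurableType d) (R : realType).

Lemma measurable_xsection_fun (K : T * T -> R) x :
  measurable_fun setT K -> measurable_fun setT (fun y => K (x, y)).
Proof. by move=> mK; exact: (measurableT_comp mK (measurable_pair1 x)). Qed.

Lemma measurable_ysection_fun (K : T * T -> R) y :
  measurable_fun setT K -> measurable_fun setT (fun x => K (x, y)).
Proof. by move=> mK; exact: (measurableT_comp mK (measurable_pair2 y)). Qed.

(** Tonelli for the positive and the negative part; this covers sections that are not integrable,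
    where [fine] may supply a default value. *)
Lemma measurable_Rintegral d' (X : measurableType d')
    (mu : {sigma_finite_measure set T -> \bar R}) (h : X * T -> R) :
  measurable_fun setT h -> measurable_fun setT (fun x => \int[mu]_z h (x, z)).
Proof.
move=> mh; apply: (measurableT_comp (fine_measurable measurableT)).
have mEh : measurable_fun setT (EFin \o h) by exact/measurable_EFinP.
rewrite (_ : (fun _ => _) = (fun x => \int[mu]_z (EFin \o h)^\+ (x, z)
    - \int[mu]_z (EFin \o h)^\- (x, z))%E).
  apply: emeasurable_funB.
    by apply: measurable_fun_fubini_tonelli_F => //; exact: measurable_funepos.
  by apply: measurable_fun_fubini_tonelli_F => //; exact: measurable_funeneg.
apply/funext => x; rewrite [LHS]integralE; congr (_ - _)%E; apply: eq_integral => z _.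
  by rewrite !funeposE.
by rewrite !funenegE.
Qed.

End product_sections.

Section kernels.
Context d (T : measurableType d) (R : realType).
Variable mu : {finite_measure set T -> \bar R}.
Local Notation mu2 := (mu \x mu)%E.
Local Notation L2 := (Lfun mu 2%:E).
Local Notation L2K := (Lfun mu2 2%:E).
Local Notation nrm := (nrm2 mu).
Local Notation nrmK := (nrm2 mu2).
Local Notation op := (kernel_operator mu).
Implicit Types (K H : T * T -> R) (f g h : T -> R).

Lemma kernel_sqr1 K : K \in L2K ->
  (\int[mu]_x \int[mu]_y (K (x, y) ^+ 2)%:E = (nrmK K ^+ 2)%:E)%E.
Proof.
move=> KL; rewrite -(nrm2_sqr KL).
rewrite (fubini_tonelli1 (fun p => (K p ^+ 2)%:E))//.
- by apply/measurable_EFinP/measurable_funX; exact: (Lfun2_measurable KL).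
- by move=> p; rewrite lee_fin sqr_ge0.
Qed.

Lemma kernel_sqr2 K : K \in L2K ->
  (\int[mu]_y \int[mu]_x (K (x, y) ^+ 2)%:E = (nrmK K ^+ 2)%:E)%E.
Proof.
move=> KL; rewrite -(nrm2_sqr KL).
rewrite (fubini_tonelli2 (fun p => (K p ^+ 2)%:E))//.
- by apply/measurable_EFinP/measurable_funX; exact: (Lfun2_measurable KL).
- by move=> p; rewrite lee_fin sqr_ge0.
Qed.

Lemma kernel_integrable_sqr K : K \in L2K ->
  mu2.-integrable setT (fun p => (K p ^+ 2)%:E).
Proof. exact: Lfun2_integrable_sqr. Qed.

Lemma ae_xsection_Lfun2 K : K \in L2K ->
  {ae mu, forall x, (fun y => K (x, y)) \in L2}.
Proof.
move=> KL; have mK := Lfun2_measurable KL.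
apply: filterS (ae_integrable1 (kernel_integrable_sqr KL)) => x iK.
apply/Lfun2P; split; first exact: measurable_xsection_fun.
case/integrableP: iK => _; apply: le_lt_trans.
by under [leRHS]eq_integral do rewrite gee0_abs ?lee_fin ?sqr_ge0//.
Qed.

Lemma ae_ysection_Lfun2 K : K \in L2K ->
  {ae mu, forall y, (fun x => K (x, y)) \in L2}.
Proof.
move=> KL; have mK := Lfun2_measurable KL.
apply: filterS (ae_integrable2 (kernel_integrable_sqr KL)) => x iK.
apply/Lfun2P; split; first exact: measurable_ysection_fun.
case/integrableP: iK => _; apply: le_lt_trans.
by under [leRHS]eq_integral do rewrite gee0_abs ?lee_fin ?sqr_ge0//.
Qed.

Lemma kernel_operator_measurable K f : measurable_fun setT K ->
  measurable_fun setT f -> measurable_fun setT (op K f).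
Proof.
move=> mK mf; apply: (measurable_Rintegral mu (h := fun p => K p * f p.2)).
by apply: measurable_funM => //; exact: measurableT_comp.
Qed.

(** Hilbert-Schmidt bound: Cauchy-Schwarz on each row, then integration over the rows. *)
Lemma kernel_operator_L2 K f : K \in L2K -> f \in L2 ->
  op K f \in L2 /\ nrm (op K f) <= nrmK K * nrm f.
Proof.
move=> KL fL; have mK := Lfun2_measurable KL; have mf := Lfun2_measurable fL.
apply: nrm2_le.
- exact: kernel_operator_measurable.
- by rewrite mulr_ge0 ?nrm2_ge0.
rewrite exprMn EFinM -(kernel_sqr1 KL) -(nrm2_sqr fL).
have mK2 : measurable_fun setT (fun p => (K p ^+ 2)%:E).
  by apply/measurable_EFinP; exact: measurable_funX.
have K20 p : (0 <= (K p ^+ 2)%:E)%E by rewrite lee_fin sqr_ge0.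
rewrite -ge0_integralZr//; last 3 first.
- exact: (measurable_fun_fubini_tonelli_F (fun p => (K p ^+ 2)%:E)).
- by move=> x _; apply: integral_ge0.
- by apply: integral_ge0 => x _; rewrite lee_fin sqr_ge0.
apply: ge0_le_integral => //.
- by move=> x _; rewrite lee_fin sqr_ge0.
- by apply/measurable_EFinP/measurable_funX; exact: kernel_operator_measurable.
- apply: emeasurable_funM => //.
  exact: (measurable_fun_fubini_tonelli_F (fun p => (K p ^+ 2)%:E)).
- by move=> x _; apply: Cauchy_Schwarz => //; exact: measurable_xsection_fun.
Qed.

(** At [(x, y)] Cauchy-Schwarz bounds the square by a function of [x] times a function of [y], the
    squared norms of a row of [K] and of a column of [H]. *)
Lemma kernel_comp_L2 K H : K \in L2K -> H \in L2K ->
  kernel_comp mu K H \in L2K.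
Proof.
move=> KL HL; have mK := Lfun2_measurable KL; have mH := Lfun2_measurable HL.
have mKH : measurable_fun setT (kernel_comp mu K H).
  apply: (measurable_Rintegral mu
    (h := fun q : (T * T) * T => K (q.1.1, q.2) * H (q.2, q.1.2))).
  by apply: measurable_funM; apply: measurableT_comp => //;
    apply: measurable_fun_pair => //; apply: measurableT_comp.
have m2 (J : T * T -> R) : measurable_fun setT J ->
    measurable_fun setT (fun p : T * T => (J p ^+ 2)%:E).
  by move=> mJ; apply/measurable_EFinP; exact: measurable_funX.
have p0 (J : T * T -> R) p : (0 <= (J p ^+ 2)%:E)%E by rewrite lee_fin sqr_ge0.
apply: (@nrm2_le _ _ _ mu2 _ (nrmK K * nrmK H) mKH _ _).1.
  by rewrite mulr_ge0 ?nrm2_ge0.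
rewrite (fubini_tonelli1 (fun p => (kernel_comp mu K H p ^+ 2)%:E)) //; last first.
  exact: m2.
rewrite exprMn EFinM -(kernel_sqr1 KL) -(kernel_sqr2 HL).
have mF := measurable_fun_fubini_tonelli_F (m2 := mu)
  (fun p => (K p ^+ 2)%:E) (m2 _ mK) (p0 K).
have mG := measurable_fun_fubini_tonelli_G (m1 := mu)
  (fun p => (H p ^+ 2)%:E) (m2 _ mH) (p0 H).
rewrite -ge0_integralZr//; last 2 first.
- by move=> x _; apply: integral_ge0.
- by apply: integral_ge0 => x _; apply: integral_ge0.
apply: ge0_le_integral => //.
- by move=> x _; apply: integral_ge0.
- exact: (measurable_fun_fubini_tonelli_F
    (fun p => (kernel_comp mu K H p ^+ 2)%:E) (m2 _ mKH)).
- exact: emeasurable_funM.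
move=> x _; rewrite -ge0_integralZl//; last 2 first.
- by move=> y _; apply: integral_ge0.
- by apply: integral_ge0.
apply: ge0_le_integral => //.
- by apply/measurable_EFinP/measurable_funX; exact: (measurable_xsection_fun x mKH).
- exact: measurable_funeM.
move=> y _; apply: Cauchy_Schwarz; first exact: measurable_xsection_fun.
exact: measurable_ysection_fun.
Qed.

(** Fubini at a fixed [x]. The tensor product [F] of the row [K (x, _)] with [f] is square
    integrable, so [F * H] is integrable on the product. *)
Lemma kernel_operator_comp K H f : K \in L2K -> H \in L2K -> f \in L2 ->
  op (kernel_comp mu K H) f = op K (op H f) %[ae mu].
Proof.
move=> KL HL fL; have mK := Lfun2_measurable KL; have mH := Lfun2_measurable HL.
have mf := Lfun2_measurable fL.
apply: filterS2 (ae_xsection_Lfun2 KL) (ae_xsection_Lfun2 (kernel_comp_L2 KL HL)).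
move=> x KxL KHxL _.
pose F (p : T * T) := K (x, p.1) * f p.2.
have mKx := Lfun2_measurable KxL.
have mF : measurable_fun setT F.
  apply: measurable_funM; first exact: (measurableT_comp mKx measurable_fst).
  exact: (measurableT_comp mf measurable_snd).
have FL : F \in L2K.
  apply: (@nrm2_le _ _ _ mu2 _ (nrm (fun y => K (x, y)) * nrm f) mF _ _).1.
    by rewrite mulr_ge0 ?nrm2_ge0.
  rewrite (fubini_tonelli1 (fun p => (F p ^+ 2)%:E)); last 2 first.
  - by apply/measurable_EFinP; exact: measurable_funX.
  - by move=> p; rewrite lee_fin sqr_ge0.
  rewrite exprMn EFinM -(nrm2_sqr KxL) -(nrm2_sqr fL) -ge0_integralZr//; last 3 first.
  - by apply/measurable_EFinP; exact: measurable_funX.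
  - by move=> z _; rewrite lee_fin sqr_ge0.
  - by apply: integral_ge0 => z _; rewrite lee_fin sqr_ge0.
  apply: ge0_le_integral => //.
  - by move=> z _; apply: integral_ge0 => y _; rewrite lee_fin sqr_ge0.
  - apply: (measurable_fun_fubini_tonelli_F (fun p => (F p ^+ 2)%:E)).
      by apply/measurable_EFinP; exact: measurable_funX.
    by move=> p; rewrite lee_fin sqr_ge0.
  - apply: emeasurable_funM => //.
    by apply/measurable_EFinP; exact: measurable_funX.
  move=> z _; rewrite /fubini_F/= /F/=.
  under eq_integral do rewrite exprMn EFinM.
  rewrite ge0_integralZl//.
  - by apply/measurable_EFinP; exact: measurable_funX.
  - by move=> y _; rewrite lee_fin sqr_ge0.
  - by rewrite lee_fin sqr_ge0.
have iFH : mu2.-integrable setT (EFin \o (fun p => F p * H p)).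
  exact: Lfun2_integrableM.
have := Fubini iFH; rewrite /= => E.
rewrite /kernel_operator /Rintegral; congr fine.
transitivity (\int[mu]_y \int[mu]_z (F (z, y) * H (z, y))%:E)%E.
  have := ae_integrable2 iFH => iae.
  apply: ae_eq_integral => //.
  - apply/measurable_EFinP; apply: measurable_funM => //.
    exact: (measurable_xsection_fun x (Lfun2_measurable (kernel_comp_L2 KL HL))).
  - exact: measurable_fubini_G iFH.
  have := ae_ysection_Lfun2 HL; apply: filterS2 iae => y iy HyL _.
  rewrite /kernel_comp /kernel_operator/=.
  rewrite -RintegralZr//; last exact: Lfun2_integrableM.
  rewrite /Rintegral fineK; last first.
    apply: integrable_fin_num => //.
    apply: eq_integrable iy => // z _ /=; rewrite /F/=; congr EFin; ring.
  by apply: eq_integral => z _; rewrite /F/=; congr EFin; ring.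
rewrite -E.
have := ae_integrable1 iFH => iae.
apply: ae_eq_integral => //.
- exact: measurable_fubini_F iFH.
- apply/measurable_EFinP; apply: measurable_funM => //.
  exact: kernel_operator_measurable.
have := ae_xsection_Lfun2 HL; apply: filterS2 iae => z iz HzL _.
rewrite -RintegralZl//; last exact: Lfun2_integrableM.
rewrite /Rintegral fineK; last first.
  apply: integrable_fin_num => //.
  apply: eq_integrable iz => // y _ /=; rewrite /F/=; congr EFin; ring.
by apply: eq_integral => y _; rewrite /F/=; congr EFin; ring.
Qed.

Lemma kernel_operatorD K H f : K \in L2K -> H \in L2K -> f \in L2 ->
  op (K \+ H) f = op K f \+ op H f %[ae mu].
Proof.
move=> KL HL fL.
apply: filterS2 (ae_xsection_Lfun2 KL) (ae_xsection_Lfun2 HL) => x Kx Hx _.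
rewrite /kernel_operator /= -RintegralD//; [|exact: Lfun2_integrableM..].
by apply: eq_Rintegral => y _; rewrite mulrDl.
Qed.

Lemma kernel_operatorZ c K f : K \in L2K -> f \in L2 ->
  op (fun p => c * K p) f = (fun x => c * op K f x) %[ae mu].
Proof.
move=> KL fL; apply: filterS (ae_xsection_Lfun2 KL) => x Kx _.
rewrite /kernel_operator /= -RintegralZl//; last exact: Lfun2_integrableM.
by apply: eq_Rintegral => y _; rewrite mulrA.
Qed.

Lemma kernel_operatorB K f g : K \in L2K -> f \in L2 -> g \in L2 ->
  op K (f \- g) = op K f \- op K g %[ae mu].
Proof.
move=> KL fL gL; apply: filterS (ae_xsection_Lfun2 KL) => x Kx _.
rewrite /kernel_operator /= -RintegralB//; [|exact: Lfun2_integrableM..].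
by apply: eq_Rintegral => y _; rewrite mulrBr.
Qed.

Lemma kernel_operator_bounded K : K \in L2K ->
  bounded_linear_L2 mu (op K) (nrmK K).
Proof.
move=> KL; have KfL f : f \in L2 -> op K f \in L2.
  by move=> fL; exact: (kernel_operator_L2 KL fL).1.
split=> // [f g fL gL|f fL]; last exact: (kernel_operator_L2 KL fL).2.
apply/nrm2B_eq0; first by apply: KfL; exact: Lfun2B.
  by apply: Lfun2B; exact: KfL.
exact: kernel_operatorB.
Qed.

(** The difference [K \- H] has norm 0, hence by the Hilbert-Schmidt bound so has its operator; no
    passage to sections of a null set of the product is made. *)
Lemma kernel_operator_ae_eq K H f : K \in L2K -> H \in L2K -> f \in L2 ->
  K = H %[ae mu2] -> op K f = op H f %[ae mu].
Proof.
move=> KL HL fL KH.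
have KfL := (kernel_operator_L2 KL fL).1; have HfL := (kernel_operator_L2 HL fL).1.
have KHL := Lfun2B KL HL.
have DfL := (kernel_operator_L2 KHL fL).1.
have D0 : op (K \- H) f = cst 0 %[ae mu].
  apply: nrm2_eq0 => //; apply/eqP; rewrite eq_le nrm2_ge0 andbT.
  have [_ /le_trans] := kernel_operator_L2 KHL fL; apply.
  by rewrite ((nrm2B_eq0 KL HL).2 KH) mul0r.
have : op ((K \- H) \+ H) f = op (K \- H) f \+ op H f %[ae mu].
  exact: kernel_operatorD.
rewrite (_ : (K \- H) \+ H = K); last by apply/funext => p /=; rewrite subrK.
by apply: filterS2 D0 => x /(_ I) /= D0 /(_ I) -> _; rewrite D0 add0r.
Qed.

(** Fubini, which applies because on a finite measure [(x, y) |-> f y] is square integrable on the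
    product, so that its product with [K] is integrable. *)
Lemma Rintegral_kernel_operator K f : K \in L2K -> f \in L2 ->
  \int[mu]_x op K f x = \int[mu]_y ((\int[mu]_x K (x, y)) * f y).
Proof.
move=> KL fL; have mK := Lfun2_measurable KL; have mf := Lfun2_measurable fL.
have oneL : (cst 1 : T -> R) \in L2 by exact: Lfun_cst.
have fsndL : (fun p : T * T => f p.2) \in L2K.
  apply/Lfun2P; split; first exact: measurableT_comp.
  rewrite (fubini_tonelli1 (fun p => (f p.2 ^+ 2)%:E)); last 2 first.
  - by apply/measurable_EFinP/measurable_funX; exact: measurableT_comp.
  - by move=> p; rewrite lee_fin sqr_ge0.
  rewrite /fubini_F /= (nrm2_sqr fL) integral_cst//.
  by rewrite lte_mul_pinfty// ?lee_fin ?sqr_ge0// -ge0_fin_numE ?fin_num_measure.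
have iKf : mu2.-integrable setT (EFin \o (fun p => K p * f p.2)).
  exact: Lfun2_integrableM.
have := Fubini iKf; rewrite /= => E.
rewrite {1 2}/Rintegral; congr fine.
transitivity (\int[mu]_x \int[mu]_y (K (x, y) * f y)%:E)%E.
  apply: ae_eq_integral => //.
  - by apply/measurable_EFinP; exact: kernel_operator_measurable.
  - exact: measurable_fubini_F iKf.
  apply: filterS (ae_integrable1 iKf) => x ix _.
  by rewrite /kernel_operator /Rintegral fineK//; exact: integrable_fin_num.
rewrite E; apply: ae_eq_integral => //.
- exact: measurable_fubini_G iKf.
- apply/measurable_EFinP; apply: measurable_funM => //.
  apply: (measurable_Rintegral mu (h := fun p => K (p.2, p.1))).
  by apply: measurableT_comp => //; exact: measurable_swap.
apply: filterS2 (ae_integrable2 iKf) (ae_ysection_Lfun2 KL) => y iy KyL _.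
rewrite -RintegralZr//; last first.
  have := Lfun2_integrableM KyL oneL; rewrite /comp /=.
  by under eq_fun do rewrite mulr1.
by rewrite /Rintegral fineK//; exact: integrable_fin_num.
Qed.

End kernels.

(** * Powers of a kernel operator *)
Section power_contraction.
Context d (T : measurableType d) (R : realType).
Variable mu : {finite_measure set T -> \bar R}.
Local Notation mu2 := (mu \x mu)%E.
Local Notation L2 := (Lfun mu 2%:E).
Local Notation L2K := (Lfun mu2 2%:E).
Local Notation nrm := (nrm2 mu).
Local Notation nrmK := (nrm2 mu2).
Local Notation op := (kernel_operator mu).
Local Notation comp := (kernel_comp mu).
Implicit Types (K H : T * T -> R) (f g h : T -> R).

Lemma iter_additive A a n f g : 0 <= a -> bounded_linear_L2 mu A a ->
  f \in L2 -> g \in L2 ->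
  nrm (iter n A (f \- g) \- (iter n A f \- iter n A g)) = 0.
Proof.
move=> a0 Aa fL gL; have Alip := bounded_linear_lipschitz Aa.
have [AL AB _] := Aa; have AiL k := stable_L2_iter k AL.
have fgL := Lfun2B fL gL.
elim: n => [|n IH] /=; first exact/(nrm2B_eq0 fgL fgL)/ae_eq_refl.
have iL : iter n A f \- iter n A g \in L2 by apply: Lfun2B; exact: AiL.
apply: (@nrm2_dist0_trans _ _ _ _ _ (A (iter n A f \- iter n A g))).
- by apply: AL; exact: AiL.
- exact: AL.
- by apply: Lfun2B; apply: AL; exact: AiL.
- apply/eqP; rewrite eq_le nrm2_ge0 andbT.
  by rewrite (le_trans (Alip _ _ (AiL n _ fgL) iL))// IH mulr0.
- by apply: AB; exact: AiL.
Qed.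

Lemma iter_kernel_comp_section K H n y :
  (fun x => iter n (comp K) H (x, y)) = iter n (op K) (fun x => H (x, y)).
Proof. by elim: n => //= n <-. Qed.

Lemma iter_kernel_comp_L2 K H n : K \in L2K -> H \in L2K ->
  iter n (comp K) H \in L2K.
Proof. by move=> KL HL; elim: n => //= n IH; exact: kernel_comp_L2. Qed.

(** Turns smallness of a kernel in Hilbert-Schmidt norm into smallness of an operator: composing
    kernels and composing operators agree almost everywhere. *)
Lemma iter_kernel_comp_le K H n f : K \in L2K -> H \in L2K -> f \in L2 ->
  nrm (iter n (op K) (op H f)) <= nrmK (iter n (comp K) H) * nrm f.
Proof.
move=> KL HL fL; have Kb := kernel_operator_bounded KL.
have Klip := bounded_linear_lipschitz Kb; have [KS _ _] := Kb.
have HnL k := iter_kernel_comp_L2 k KL HL.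
have HfL := (kernel_operator_L2 HL fL).1.
have iL k := stable_L2_iter k KS HfL.
have oL k := (kernel_operator_L2 (HnL k) fL).1.
have E k : nrm (iter k (op K) (op H f) \- op (iter k (comp K) H) f) = 0.
  elim: k => [|k IH] /=; first exact/(nrm2B_eq0 HfL HfL)/ae_eq_refl.
  apply: (@nrm2_dist0_trans _ _ _ _ _ (op K (op (iter k (comp K) H) f))).
  - exact: (iL k.+1).
  - exact: KS.
  - exact: (oL k.+1).
  - apply/eqP; rewrite eq_le nrm2_ge0 andbT.
    by rewrite (le_trans (Klip _ _ (iL k) (oL k)))// IH mulr0.
  - rewrite nrm2BC; apply/nrm2B_eq0; [exact: (oL k.+1)|exact: KS|].
    exact: kernel_operator_comp.
by rewrite (nrm2_eq (iL n) (oL n) (E n)); exact: (kernel_operator_L2 (HnL n) fL).2.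
Qed.

Definition column_restriction H (A : set T) : T * T -> R :=
  fun p => H p * (p.2 \in A)%:R.

(** Composition on the left acts on each column separately, so columns may be discarded before or
    after iterating. *)
Lemma iter_kernel_comp_restriction K H A n :
  iter n (comp K) (column_restriction H A) =
  column_restriction (iter n (comp K) H) A.
Proof.
elim: n => //= n ->; apply/funext => -[x y]; rewrite /column_restriction.
rewrite /kernel_comp /kernel_operator /=; case: (y \in A).
  by rewrite mulr1; apply: eq_Rintegral => z _; rewrite mulr1.
rewrite mulr0; under eq_Rintegral do rewrite mulr0 mulr0.
by rewrite Rintegral_cst// mul0r.
Qed.

Lemma column_restriction_L2 H A : H \in L2K -> measurable A ->
  column_restriction H A \in L2K /\
  ((nrmK (column_restriction H A) ^+ 2)%:E =
   \int[mu]_y ((\int[mu]_x (H (x, y) ^+ 2)%:E) * (y \in A)%:R%:E))%E.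
Proof.
move=> HL mA; have mH := Lfun2_measurable HL.
have mIA : measurable_fun setT (fun y => (y \in A)%:R : R) by exact: measurable_indic.
have mHA : measurable_fun setT (column_restriction H A).
  apply: measurable_funM => //; exact: (measurableT_comp mIA measurable_snd).
have HAL : column_restriction H A \in L2K.
  apply/Lfun2P; split=> //; case/Lfun2P: HL => _; apply: le_lt_trans.
  apply: ge0_le_integral => //.
  - by move=> p _; rewrite lee_fin sqr_ge0.
  - by apply/measurable_EFinP; exact: measurable_funX.
  - by apply/measurable_EFinP; exact: measurable_funX.
  - move=> p _; rewrite lee_fin /column_restriction; case: (_ \in _).
      by rewrite mulr1.
    by rewrite mulr0 expr0n sqr_ge0.
split=> //; rewrite -(kernel_sqr2 HAL); apply: eq_integral => y _.
rewrite /column_restriction /=; case: (y \in A).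
  by rewrite mule1; apply: eq_integral => x _; rewrite mulr1.
by rewrite mule0 integral0_eq// => x _; rewrite mulr0 expr0n.
Qed.

(* Let [a_n(y)] be the norm of the n-th iterate on the column [K(., y)]. Split [K]
   into the columns with [sup_n a_n(y)^2 <= M] and the others. On the first part
   the kernels of the iterates tend to 0 by dominated convergence (constant [M]);
   the second part is small for large [M]. Hence the norms [b_n] of the powers
   satisfy [b_(n+1) <= 1/8 + b_n/4] for large [n]. *)
Lemma kernel_power_contraction K : K \in L2K ->
  {ae mu, forall y,
    (fun n => nrm (iter n (op K) (fun x => K (x, y)))) @ \oo --> (0 : R)} ->
  exists N, forall f, f \in L2 -> nrm (iter N (op K) f) <= 2^-1 * nrm f.
Proof.
move=> KL Kto0.
have Kb := kernel_operator_bounded KL; have Klip := bounded_linear_lipschitz Kb.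
have [KS _ _] := Kb; have a0 := nrm2_ge0 mu2 K.
pose Kn n := iter n (comp K) K.
have KnL n : Kn n \in L2K by exact: iter_kernel_comp_L2.
pose q n y : \bar R := (\int[mu]_x (Kn n (x, y) ^+ 2)%:E)%E.
have q0 n y : (0 <= q n y)%E by apply: integral_ge0 => x _; rewrite lee_fin sqr_ge0.
have mq n : measurable_fun setT (q n).
  apply: (measurable_fun_fubini_tonelli_G (fun p => (Kn n p ^+ 2)%:E)).
    by apply/measurable_EFinP/measurable_funX; exact: (Lfun2_measurable (KnL n)).
  by move=> p; rewrite lee_fin sqr_ge0.
have q_cvg : {ae mu, forall y, (forall n, q n y \is a fin_num) /\
    (fun n => q n y) @ \oo --> 0%E}.
  have KnL_ae : {ae mu, forall y n, (fun x => Kn n (x, y)) \in L2}.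
    by apply: ae_foralln => n; exact: ae_ysection_Lfun2.
  apply: filterS2 Kto0 KnL_ae => y ycvg yL.
  have qE n : q n y = (nrm (iter n (op K) (fun x => K (x, y))) ^+ 2)%:E.
    by rewrite -iter_kernel_comp_section -(nrm2_sqr (yL n)).
  split=> [n|]; first by rewrite qE.
  rewrite (funext qE); apply: cvg_EFin; first exact: nearW.
  rewrite (_ : 0 = 0 ^+ 2); last by rewrite expr0n.
  exact: cvg_sqr.
pose B (M : nat) := \bigcup_n [set y | (M%:R%:E < q n y)%E].
have mB M : measurable (B M).
  apply: bigcup_measurable => n _; rewrite -[X in measurable X]setTI.
  by apply: measurable_lte => //; exact: measurable_cst.
have B_ae : {ae mu, forall y, \forall M \near \oo, y \notin B M}.
  apply: filterS q_cvg => y [qfin q_0].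
  have : \forall n \near \oo, (q n y <= 1)%E.
    have /fine_cvgP[_ /cvgr_le] := q_0 => /(_ 1); rewrite ltr01 => /(_ isT).
    by apply: filterS => n /=; rewrite -lee_fin fineK.
  move=> [n0 _ n0P].
  (* A sequence tending to 0 is bounded: finitely many early terms are summed, and 1 covers the
     rest. *)
  pose b := \sum_(i < n0) fine (q i y) + 1.
  have qb n : fine (q n y) <= b.
    have [nn0|nn0] := ltnP n n0.
      rewrite /b (bigD1 (Ordinal nn0))//= -addrA lerDl addr_ge0//.
      by apply: sumr_ge0 => i _; rewrite fine_ge0.
    rewrite -lee_fin fineK// (le_trans (n0P n nn0))// lee_fin lerDr.
    by apply: sumr_ge0 => i _; rewrite fine_ge0.
  have [M0 M0b] : exists M0 : nat, b <= M0%:R.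
    by exists (Num.truncn b).+1; rewrite ltW// truncnS_gt.
  exists M0 => // M /= M0M; apply/negP; rewrite inE => -[n _] /=.
  rewrite -(fineK (qfin n)) lte_fin ltNge (le_trans (qb n))//.
  by rewrite (le_trans M0b)// ler_nat.
have tail0 : (fun M => nrmK (column_restriction K (B M))) @ \oo --> (0 : R).
  apply: cvg_sqr0 => [M|]; first exact: nrm2_ge0.
  rewrite (_ : (fun M => _) = (fun M => \int[mu]_y (q 0%N y * (y \in B M)%:R%:E))%E).
    have [|||||_ _] := @dominated_convergence _ _ _ mu _ measurableT
      (fun M y => q 0%N y * (y \in B M)%:R%:E)%E (cst 0%E) (q 0%N).
    - move=> M; apply: emeasurable_funM => //.
      by apply/measurable_EFinP; exact: measurable_indic.
    - exact: measurable_cst.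
    - apply: filterS B_ae => y By _; apply: cvg_near_cst.
      by apply: filterS By => M /negbTE ->; rewrite mule0.
    - apply/integrableP; split=> //.
      under eq_integral do rewrite gee0_abs//.
      by rewrite (kernel_sqr2 KL) ltry.
    - apply: aeW => y M _; case: (y \in B M); rewrite ?mule1 ?mule0 ?abse0//.
      by rewrite gee0_abs.
    by rewrite integral_cst// mul0e.
  by apply/funext => M; rewrite (column_restriction_L2 KL (mB M)).2.
have head0 M : (fun n => nrmK (column_restriction (Kn n) (~` B M))) @ \oo --> (0 : R).
  have mBM := measurableC (mB M).
  apply: cvg_sqr0 => [n|]; first exact: nrm2_ge0.
  rewrite (_ : (fun n => _) = (fun n => \int[mu]_y (q n y * (y \in ~` B M)%:R%:E))%E).
    have [|||||_ _] := @dominated_convergence _ _ _ mu _ measurableT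
      (fun n y => q n y * (y \in ~` B M)%:R%:E)%E (cst 0%E) (cst M%:R%:E).
    - move=> n; apply: emeasurable_funM => //.
      by apply/measurable_EFinP; exact: measurable_indic.
    - exact: measurable_cst.
    - apply: filterS q_cvg => y [_ qy] _; case: (y \in ~` B M).
        by under eq_fun do rewrite mule1.
      by under eq_fun do rewrite mule0; exact: cvg_cst.
    - exact: finite_measure_integrable_cst.
    - apply: aeW => y n _; have [yB|] := boolP (y \in ~` B M); last first.
        by rewrite mule0 abse0 lee_fin.
      rewrite mule1 gee0_abs//= leNgt; apply/negP => qn.
      by move: yB; rewrite inE; apply; exists n.
    by rewrite integral_cst// mul0e.
  by apply/funext => n; rewrite (column_restriction_L2 (KnL n) mBM).2.
have e4 : (0 : R) < 4^-1 by rewrite invr_gt0.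
have e8 : (0 : R) < 8^-1 by rewrite invr_gt0.
have [M _ /(_ M (leqnn M)) HM] : \forall M \near \oo,
  nrmK (column_restriction K (B M)) <= 4^-1 by exact: (cvgr_le _ tail0).
have [N0 _ HN0] : \forall n \near \oo,
  nrmK (column_restriction (Kn n) (~` B M)) <= 8^-1 by exact: (cvgr_le _ (head0 M)).
pose H1 := column_restriction K (~` B M); pose H2 := column_restriction K (B M).
have H1L : H1 \in L2K := (column_restriction_L2 KL (measurableC (mB M))).1.
have H2L : H2 \in L2K := (column_restriction_L2 KL (mB M)).1.
have KE : K = H1 \+ H2.
  apply/funext => p; rewrite /H1 /H2 /column_restriction /= in_setC.
  by case: (_ \in _); rewrite mulr1 mulr0 ?addr0 ?add0r.
(* [D] bounds the [N0]-th power and starts the induction. The constant [4^-1] is preserved by the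
   recursion since [8^-1 + 4^-1 * 4^-1 <= 4^-1], while the [D] term shrinks by a factor 4. The
   induction hypothesis must hold for all [f], as it is applied to [op K f \- op H1 f]. *)
pose D := nrmK K ^+ N0.
have bound m f : f \in L2 ->
    nrm (iter (N0 + m) (op K) f) <= (4^-1 + D * 4^-1 ^+ m) * nrm f.
  elim: m f => [|m IH] f fL.
    have zL : (fun=> 0 : R) \in L2 by exact: (Lfun_cst mu 0 2).
    have iterb n g : g \in L2 -> nrm (iter n (op K) g) <= nrmK K ^+ n * nrm g.
      move=> gL; elim: n => [|n IHn]; first by rewrite expr0 mul1r.
      have [_ _ Kbd] := Kb; rewrite iterS (le_trans (Kbd _ (stable_L2_iter n KS gL)))//.
      by rewrite exprS -mulrA ler_wpM2l.
    rewrite addn0 expr0 mulr1 (le_trans (iterb N0 f fL))//.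
    by rewrite ler_wpM2r ?nrm2_ge0// lerDr ltW.
  rewrite addnS iterSr; set n := (N0 + m)%N.
  have oL H : H \in L2K -> op H f \in L2.
    by move=> HL; exact: (kernel_operator_L2 HL fL).1.
  have iL := stable_L2_iter n KS.
  have h1 := ler_nrm2 (iL _ (oL _ KL)) (iL _ (oL _ H1L)).
  have h2 : nrm (iter n (op K) (op H1 f)) <= 8^-1 * nrm f.
    rewrite (le_trans (iter_kernel_comp_le n KL H1L fL))// ler_wpM2r ?nrm2_ge0//.
    by rewrite iter_kernel_comp_restriction; apply: HN0; exact: leq_addr.
  have dL := Lfun2B (oL _ KL) (oL _ H1L).
  have h3 : nrm (iter n (op K) (op K f) \- iter n (op K) (op H1 f)) <=
      (4^-1 + D * 4^-1 ^+ m) * nrm (op K f \- op H1 f).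
    rewrite -(nrm2_eq _ _ (iter_additive n a0 Kb (oL _ KL) (oL _ H1L))).
    - exact: IH.
    - exact: iL.
    - by apply: Lfun2B; apply: iL; exact: oL.
  have h4 : nrm (op K f \- op H1 f) <= 4^-1 * nrm f.
    rewrite (nrm2_eq dL (oL _ H2L)).
      by rewrite (le_trans (kernel_operator_L2 H2L fL).2)// ler_wpM2r ?nrm2_ge0.
    apply/nrm2B_eq0 => //; first exact: oL.
    have := kernel_operatorD H1L H2L fL; rewrite -KE.
    by apply: filterS => x /(_ I) /= -> _; rewrite addrC addKr.
  have D0 : 0 <= D * 4^-1 ^+ m by rewrite mulr_ge0 ?exprn_ge0// ltW.
  have h5 := ler_wpM2l (_ : 0 <= 4^-1 + D * 4^-1 ^+ m) h4.
  have {}h5 := h5 (addr_ge0 (ltW e4) D0).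
  rewrite exprS; have := nrm2_ge0 mu f; nra.
(* Once the [D] term is at most [4^-1], the two quarters add up to the contraction factor [2^-1]. *)
have : (fun m => D * 4^-1 ^+ m) @ \oo --> (0 : R).
  by apply: cvg_geometric; rewrite ger0_norm ?ltW// invf_lt1// ltr1n.
move=> /cvgr_le /(_ _ e4) [m _ /(_ m (leqnn m)) /= Dm].
exists (N0 + m)%N => f fL; apply: le_trans (bound m f fL) _.
rewrite ler_wpM2r ?nrm2_ge0//; lra.
Qed.

End power_contraction.

(** * Linear response *)
Section response.
Context d (T : measurableType d) (R : realType).
Variable mu : {finite_measure set T -> \bar R}.
Local Notation mu2 := (mu \x mu)%E.
Local Notation L2 := (Lfun mu 2%:E).
Local Notation L2K := (Lfun mu2 2%:E).
Local Notation nrm := (nrm2 mu).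
Local Notation nrmK := (nrm2 mu2).
Local Notation op := (kernel_operator mu).
Local Notation mean f := (\int[mu]_x f x).
Local Notation one := (cst 1 : T -> R).
Local Notation shift K := (K \- (cst 1 : T * T -> R)).
Implicit Types (K H : T * T -> R) (f g h : T -> R).

Lemma Lfun2_one : one \in L2. Proof. exact: Lfun_cst. Qed.

Lemma Lfun2_integrable f : f \in L2 -> mu.-integrable setT (EFin \o f).
Proof.
move=> fL; have := Lfun2_integrableM fL Lfun2_one; rewrite /comp /=.
by under eq_fun do rewrite mulr1.
Qed.

Lemma mean_le f : f \in L2 -> `|mean f| <= nrm f * nrm one.
Proof.
move=> fL; have := Cauchy_Schwarz_L2 fL Lfun2_one.
by under eq_Rintegral do rewrite mulr1.
Qed.

Lemma meanB f g : f \in L2 -> g \in L2 -> mean (f \- g) = mean f - mean g.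
Proof. by move=> fL gL; rewrite -RintegralB//; exact: Lfun2_integrable. Qed.

Lemma mean_nrm2_eq f g : f \in L2 -> g \in L2 -> nrm (f \- g) = 0 ->
  mean f = mean g.
Proof.
move=> fL gL fg; apply/eqP; rewrite -subr_eq0 -meanB// -normr_le0.
by rewrite (le_trans (mean_le (Lfun2B fL gL)))// fg mul0r.
Qed.

Lemma kernel_operator_stable K f : K \in L2K -> f \in L2 -> op K f \in L2.
Proof. by move=> KL fL; exact: (kernel_operator_L2 KL fL).1. Qed.

Lemma cst_kernel_L2 : (cst 1 : T * T -> R) \in L2K.
Proof.
apply/Lfun2P; split; first exact: measurable_cst.
under eq_integral do rewrite expr1n.
rewrite integral_cst// mul1e; apply: (@le_lt_trans _ _ (mu setT * mu setT)%E).
  by rewrite -product_measure1E// setXTT.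
by rewrite -ge0_fin_numE ?mule_ge0// fin_numM// fin_num_measure.
Qed.

Lemma shift_L2 K : K \in L2K -> shift K \in L2K.
Proof. by move=> KL; apply: Lfun2B => //; exact: cst_kernel_L2. Qed.

Lemma kernel_operator_shift K f : K \in L2K -> f \in L2 ->
  op (shift K) f = op K f \- cst (mean f) %[ae mu].
Proof.
move=> KL fL; apply: filterS (ae_xsection_Lfun2 KL) => x Kx _.
rewrite /kernel_operator /= -RintegralB//.
- by apply: eq_Rintegral => y _; rewrite mulrBl mul1r.
- exact: Lfun2_integrableM.
- exact: Lfun2_integrable.
Qed.

Lemma kernel_operatorZr c K f : K \in L2K -> f \in L2 ->
  op K (fun x => c * f x) = (fun x => c * op K f x) %[ae mu].
Proof.
move=> KL fL; apply: filterS (ae_xsection_Lfun2 KL) => x Kx _.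
rewrite /kernel_operator /= -RintegralZl//; last exact: Lfun2_integrableM.
by apply: eq_Rintegral => y _; rewrite mulrCA.
Qed.

Definition mean_preserving K := forall g, g \in L2 -> mean (op K g) = mean g.

Hypothesis mu1 : (mu : {measure set T -> \bar R}) setT = 1%E.

Lemma mean_cst c : mean (cst c : T -> R) = c.
Proof. by rewrite Rintegral_cst// mu1 mulr1. Qed.

(** The subtracted constant is the mean of [f], and the total mass is 1. Consequently
    [f - op (shift K) f] has the same mean as [f], so the mean of a solution can be read off the
    right-hand side. *)
Lemma mean_shift K f : K \in L2K -> mean_preserving K -> f \in L2 ->
  mean (op (shift K) f) = 0.
Proof.
move=> KL Kp fL; have oL := kernel_operator_stable KL fL.
have cL : (cst (mean f) : T -> R) \in L2 by exact: Lfun_cst.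
rewrite (@mean_nrm2_eq _ (op K f \- cst (mean f))).
- by rewrite meanB// mean_cst Kp// subrr.
- by apply: kernel_operator_stable => //; exact: shift_L2.
- exact: Lfun2B.
- apply/nrm2B_eq0; last exact: kernel_operator_shift.
    by apply: kernel_operator_stable => //; exact: shift_L2.
  exact: Lfun2B.
Qed.

Lemma shift_mean0 K f : K \in L2K -> f \in L2 -> mean f = 0 ->
  op (shift K) f = op K f %[ae mu].
Proof.
move=> KL fL f0; apply: filterS (kernel_operator_shift KL fL) => x /(_ I) -> _.
by rewrite /= f0 subr0.
Qed.

(** Taking means in the shifted equation yields [mean f = 1]; the equation then reads
    [f - op K f + 1 = 1]. Normalization and invariance thus become a single inhomogeneous
    equation. *)
Lemma invariant_shiftP K f : K \in L2K -> mean_preserving K -> f \in L2 ->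
  (mean f = 1 /\ op K f = f %[ae mu]) <->
  nrm ((f \- op (shift K) f) \- one) = 0.
Proof.
move=> KL Kp fL; have sL := kernel_operator_stable (shift_L2 KL) fL.
have fsL := Lfun2B fL sL; split=> [[f1 Kf]|f1].
  apply/(nrm2B_eq0 fsL Lfun2_one).
  apply: filterS2 Kf (kernel_operator_shift KL fL) => x /(_ I) Kf /(_ I) /= E _.
  by rewrite E Kf f1; ring.
have mf : mean f = 1.
  have := mean_nrm2_eq fsL Lfun2_one f1.
  by rewrite meanB// mean_shift// subr0 mean_cst.
split=> //; have /(nrm2B_eq0 fsL Lfun2_one) := f1.
move=> Ef; apply: filterS2 Ef (kernel_operator_shift KL fL) => x /(_ I) /= Ef /(_ I) /= E _.
by move: Ef; rewrite E mf; lra.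
Qed.

Lemma shift_invertible K : K \in L2K -> mean_preserving K ->
  {ae mu, forall y, \int[mu]_x K (x, y) = 1} ->
  (forall g, g \in L2 -> mean g = 0 ->
    (fun n => nrm (iter n (op K) g)) @ \oo --> (0 : R)) ->
  exists C, 0 <= C /\ invertible_sub1 mu (op (shift K)) C.
Proof.
move=> KL Kp K1 Kto0; have sKL := shift_L2 KL.
have sKb := kernel_operator_bounded sKL.
have [||N HN] := @kernel_power_contraction _ _ _ mu (shift K) => //; last first.
  apply: (@invertible_power _ _ _ _ _ (nrmK (shift K)) 2^-1 N) => //.
    exact: nrm2_ge0.
  by rewrite invf_lt1// ltr1n.
apply: filterS2 K1 (ae_ysection_Lfun2 KL) => y Ky1 KyL.
pose g x := K (x, y) - 1.
have gL : g \in L2 by exact: (Lfun2B KyL Lfun2_one).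
have g0 : mean g = 0.
  by rewrite (meanB KyL Lfun2_one) Ky1 mean_cst subrr.
have [KS _ _] := kernel_operator_bounded KL.
have [sKS _ _] := sKb; have sKlip := bounded_linear_lipschitz sKb.
have iL n := stable_L2_iter n KS gL; have siL n := stable_L2_iter n sKS gL.
have i0 n : mean (iter n (op K) g) = 0.
  by elim: n => //= n IH; rewrite Kp.
have E n : nrm (iter n (op (shift K)) g \- iter n (op K) g) = 0.
  elim: n => [|n IH] /=; first exact/(nrm2B_eq0 gL gL)/ae_eq_refl.
  apply: (@nrm2_dist0_trans _ _ _ _ _ (op (shift K) (iter n (op K) g))).
  - exact: (siL n.+1).
  - exact: sKS.
  - exact: (iL n.+1).
  - apply/eqP; rewrite eq_le nrm2_ge0 andbT.
    by rewrite (le_trans (sKlip _ _ (siL n) (iL n)))// IH mulr0.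
  - apply/nrm2B_eq0; [exact: sKS|exact: (iL n.+1)|exact: shift_mean0].
rewrite (_ : (fun n => _) = fun n => nrm (iter n (op K) g)); first exact: Kto0.
by apply/funext => n; exact: nrm2_eq.
Qed.

Lemma mean_column_L2 K : K \in L2K -> (fun y => \int[mu]_x K (x, y)) \in L2.
Proof.
move=> KL; have mK := Lfun2_measurable KL.
have m1 : measurable_fun setT one by exact: measurable_cst.
have mk : measurable_fun setT (fun y => \int[mu]_x K (x, y)).
  apply: (measurable_Rintegral mu (h := fun p => K (p.2, p.1))).
  by apply: measurableT_comp => //; exact: measurable_swap.
apply: (@nrm2_le _ _ _ mu _ (nrmK K) mk (nrm2_ge0 _ _) _).1.
rewrite -(kernel_sqr2 KL); apply: ge0_le_integral => //.
- by move=> y _; rewrite lee_fin sqr_ge0.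
- by apply/measurable_EFinP; exact: measurable_funX.
- apply: (measurable_fun_fubini_tonelli_G (fun p => (K p ^+ 2)%:E)).
    by apply/measurable_EFinP; exact: measurable_funX.
  by move=> p; rewrite lee_fin sqr_ge0.
move=> y _; have := Cauchy_Schwarz mu (measurable_ysection_fun y mK) m1.
under eq_Rintegral do rewrite mulr1.
under [X in (_ <= _ * X)%E -> _]eq_integral do rewrite expr1n.
by rewrite integral_cst// mul1e mu1 mule1.
Qed.

Definition kernel_expansion (K K0 Kdot r : T * T -> R) (t : R) :=
  K = (fun p => K0 p + t * Kdot p + r p) %[ae mu2].

Lemma kernel_operator_expansion K K0 Kdot r t f : K \in L2K -> K0 \in L2K ->
  Kdot \in L2K -> r \in L2K -> f \in L2 -> kernel_expansion K K0 Kdot r t ->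
  op K f = (fun x => op K0 f x + t * op Kdot f x + op r f x) %[ae mu].
Proof.
move=> KL K0L KdL rL fL KE; have tKL := Lfun2Z t KdL.
have SL := Lfun2D K0L tKL.
have h1 := kernel_operator_ae_eq KL (Lfun2D SL rL) fL KE.
have h2 := kernel_operatorD SL rL fL; have h3 := kernel_operatorD K0L tKL fL.
have h4 := kernel_operatorZ t KdL fL.
have h34 : op (K0 \+ (fun p => t * Kdot p)) f =
    (fun x => op K0 f x + t * op Kdot f x) %[ae mu].
  by apply: filterS2 h3 h4 => x /(_ I) -> /(_ I) /= -> _.
have h12 : op K f = op (K0 \+ (fun p => t * Kdot p)) f \+ op r f %[ae mu].
  by apply: filterS2 h1 h2 => x /(_ I) -> /(_ I) -> _.
by apply: filterS2 h34 h12 => x /(_ I) /= <- /(_ I) -> _.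
Qed.

Lemma kernel_operator_shiftB K K0 f : K \in L2K -> K0 \in L2K -> f \in L2 ->
  op (shift K) f = (fun x => op (shift K0) f x + (op K f x - op K0 f x)) %[ae mu].
Proof.
move=> KL K0L fL.
apply: filterS2 (kernel_operator_shift KL fL) (kernel_operator_shift K0L fL).
by move=> x /(_ I) /= -> /(_ I) /= -> _; ring.
Qed.

(* The column mean [k] of [Kdot] is orthogonal to every [g], since the mean of
   [op Kdot g] is [O(nrmK r / t)]; it suffices to test it against [g = k]. *)
Lemma mean_column_eq0 (K0 Kdot : T * T -> R) : K0 \in L2K -> Kdot \in L2K ->
  mean_preserving K0 ->
  (forall e, 0 < e -> exists t K r, 0 < t /\ [/\ K \in L2K, r \in L2K,
     mean_preserving K, kernel_expansion K K0 Kdot r t & nrmK r <= e * t]) ->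
  {ae mu, forall y, \int[mu]_x Kdot (x, y) = 0}.
Proof.
move=> K0L KdL K0p small.
pose k y := \int[mu]_x Kdot (x, y); have kL : k \in L2 by exact: mean_column_L2.
have kk : mean (op Kdot k) = 0.
  apply/eqP; rewrite -normr_le0; apply/ler_addgt0Pl => e e0; rewrite addr0.
  (* The added 1 keeps the divisor positive when [k] has norm 0. *)
  have c0 : 0 < nrm k * nrm one + 1.
    by rewrite ltr_wpDl// mulr_ge0// nrm2_ge0.
  have [t [K [r [t0 [KL rL Kp KE re]]]]] := small _ (divr_gt0 e0 c0).
  have oL H : H \in L2K -> op H k \in L2.
    by move=> HL; exact: kernel_operator_stable.
  have E : t * mean (op Kdot k) = - mean (op r k).
    have rhsL := Lfun2B (Lfun2B (oL _ KL) (oL _ K0L)) (oL _ rL).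
    transitivity (mean (fun x => t * op Kdot k x)).
      by rewrite RintegralZl//; exact/Lfun2_integrable/oL.
    transitivity (mean ((op K k \- op K0 k) \- op r k)).
      apply: mean_nrm2_eq => //; first exact/Lfun2Z/oL.
      apply/(nrm2B_eq0 (Lfun2Z t (oL _ KdL)) rhsL).
      apply: filterS (kernel_operator_expansion KL K0L KdL rL kL KE) => x /(_ I) /= -> _.
      ring.
    rewrite meanB ?meanB ?oL//; first by rewrite Kp// K0p// subrr sub0r.
    by apply: Lfun2B; exact: oL.
  have : t * `|mean (op Kdot k)| <= t * e.
    rewrite -[t in leLHS]gtr0_norm// -normrM E normrN.
    apply: le_trans (mean_le (oL _ rL)) _.
    apply: le_trans (ler_wpM2r (nrm2_ge0 _ _) (kernel_operator_L2 rL kL).2) _.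
    rewrite -mulrA; apply: le_trans (ler_wpM2r _ re) _.
      by rewrite mulr_ge0// nrm2_ge0.
    rewrite -mulrA mulrCA ler_pM2l// -mulrA ler_piMr ?ltW//.
    by rewrite mulrC ltr_pdivrMr// mul1r ltrDl.
  by rewrite ler_pM2l.
(* By Fubini the mean of [op Kdot k] is the integral of [k ^+ 2]. *)
move: kk; rewrite (Rintegral_kernel_operator KdL kL) -/k => kk.
have k0 : nrm k = 0.
  apply/eqP; rewrite -(@eqrXn2 _ 2)// ?nrm2_ge0// expr0n /=.
  rewrite -eqe -nrm2_sqr// -[X in X == _]fineK; last first.
    by rewrite nrm2_sqr.
  by rewrite eqe; apply/eqP; rewrite -[RHS]kk.
by apply: filterS (nrm2_eq0 kL k0) => y /(_ I).
Qed.

(** The constant kernels cancel in the difference of the two shifted operators, leaving the operator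
    of [t * Kdot + r], whose norm is at most [t * nrmK Kdot + nrmK r]. *)
Lemma shift_perturbation K K0 Kdot r t C : K \in L2K -> K0 \in L2K ->
  Kdot \in L2K -> r \in L2K -> 0 <= t -> kernel_expansion K K0 Kdot r t ->
  0 <= C -> C * (t * nrmK Kdot + nrmK r) <= 2^-1 ->
  invertible_sub1 mu (op (shift K0)) C ->
  invertible_sub1 mu (op (shift K)) (2 * C).
Proof.
move=> KL K0L KdL rL t0 KE C0 Cle; have EL := Lfun2D (Lfun2Z t KdL) rL.
have Ele : nrmK ((fun p => t * Kdot p) \+ r) <= t * nrmK Kdot + nrmK r.
  rewrite (le_trans (nrm2D (Lfun2Z t KdL) rL))// lerD2r nrm2Z// ger0_norm//.
have [sKS _ _] := kernel_operator_bounded (shift_L2 KL).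
apply: (@invertible_perturbation _ _ _ _ _ _
  (op ((fun p => t * Kdot p) \+ r)) _ (nrmK ((fun p => t * Kdot p) \+ r)) _ _ _ _
  (kernel_operator_bounded (shift_L2 K0L)) (kernel_operator_bounded EL)) => //.
- exact: nrm2_ge0.
- by rewrite (le_trans _ Cle)// ler_wpM2l.
move=> f fL.
apply/nrm2B_eq0; first exact: sKS.
  by apply: Lfun2D; apply: kernel_operator_stable => //; exact: shift_L2.
have h1 := kernel_operator_shiftB KL K0L fL.
have h2 := kernel_operator_expansion KL K0L KdL rL fL KE.
have h3 := kernel_operatorD (Lfun2Z t KdL) rL fL; have h4 := kernel_operatorZ t KdL fL.
have h12 : op (shift K) f =
    (fun x => op (shift K0) f x + (t * op Kdot f x + op r f x)) %[ae mu].
  by apply: filterS2 h1 h2 => x /(_ I) -> /(_ I) -> _; ring.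
have h34 : op ((fun p => t * Kdot p) \+ r) f =
    (fun x => t * op Kdot f x + op r f x) %[ae mu].
  by apply: filterS2 h3 h4 => x /(_ I) -> /(_ I) /= -> _.
by apply: filterS2 h12 h34 => x /(_ I) -> /(_ I) /= -> _.
Qed.

(* With [w := (f - f0) / t - s], the equations for [f], [f0] and [s] give
   [w - op (shift K0) w = op Kdot (f - f0) + t^-1 * op r f]. *)
Lemma response_bound K K0 Kdot r t C f f0 s : K \in L2K -> K0 \in L2K ->
  Kdot \in L2K -> r \in L2K -> 0 < t -> kernel_expansion K K0 Kdot r t ->
  0 <= C -> invertible_sub1 mu (op (shift K0)) C ->
  invertible_sub1 mu (op (shift K)) (2 * C) ->
  f \in L2 -> f0 \in L2 -> s \in L2 ->
  nrm ((f \- op (shift K) f) \- one) = 0 ->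
  nrm ((f0 \- op (shift K0) f0) \- one) = 0 ->
  nrm ((s \- op (shift K0) s) \- op Kdot f0) = 0 ->
  nrm (fun x => (f x - f0 x) / t - s x) <=
    C * (nrmK Kdot * (C * (t * nrmK Kdot + nrmK r)) + nrmK r / t) *
    (2 * C * nrm one).
Proof.
move=> KL K0L KdL rL t0 KE C0 [_ low0] [_ low] fL f0L sL fE f0E sE.
have oL H g : H \in L2K -> g \in L2 -> op H g \in L2 by exact: kernel_operator_stable.
have sKL := shift_L2 KL; have sK0L := shift_L2 K0L.
have ffL := Lfun2B fL f0L.
have hL H g (HL : H \in L2K) (gL : g \in L2) : g \- op H g \in L2.
  by apply: Lfun2B => //; exact: oL.
(* A bound on [f] that does not depend on [t], from the lower bound for the perturbed operator. *)
have f_le : nrm f <= 2 * C * nrm one.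
  by rewrite (le_trans (low f fL))// (nrm2_eq (hL _ _ sKL fL) Lfun2_one fE).
have e1 := (nrm2B_eq0 (hL _ _ sKL fL) Lfun2_one).1 fE.
have e2 := (nrm2B_eq0 (hL _ _ sK0L f0L) Lfun2_one).1 f0E.
have e3 := (nrm2B_eq0 (hL _ _ sK0L sL) (oL _ _ KdL f0L)).1 sE.
have e4 := kernel_operator_shiftB KL K0L fL.
have e5 := kernel_operator_expansion KL K0L KdL rL fL KE.
have e6 := kernel_operatorB sK0L fL f0L.
have e7 := kernel_operatorB KdL fL f0L.
have e12 : (fun x => f x - f0 x - op (shift K) f x + op (shift K0) f0 x) = cst 0 %[ae mu].
  apply: filterS2 e1 e2 => x /(_ I) /= a /(_ I) /= b _.
  lra.
have e45 : op (shift K) f =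
    (fun x => op (shift K0) f x + (t * op Kdot f x + op r f x)) %[ae mu].
  by apply: filterS2 e4 e5 => x /(_ I) -> /(_ I) -> _; ring.
have e1245 : (fun x => f x - f0 x - (op (shift K0) f x - op (shift K0) f0 x)) =
    (fun x => t * op Kdot f x + op r f x) %[ae mu].
  apply: filterS2 e12 e45 => x /(_ I) /= a /(_ I) /= b _.
  by move: a; rewrite b; lra.
have e8 : (f \- f0) \- op (shift K0) (f \- f0) =
    (fun x => t * op Kdot f x) \+ op r f %[ae mu].
  by apply: filterS2 e1245 e6 => x /(_ I) /= <- /(_ I) /= -> _.
(* First-order estimate: [(Id - op (shift K0)) (f - f0)] equals [t * op Kdot f + op r f]. *)
have ff_le : nrm (f \- f0) <= C * ((t * nrmK Kdot + nrmK r) * nrm f).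
  apply: le_trans (low0 _ ffL) _; rewrite ler_wpM2l//.
  have rhsL := Lfun2D (Lfun2Z t (oL _ _ KdL fL)) (oL _ _ rL fL).
  rewrite (nrm2_eq (hL _ _ sK0L ffL) rhsL ((nrm2B_eq0 (hL _ _ sK0L ffL) rhsL).2 e8)).
  apply: le_trans (nrm2D (Lfun2Z t (oL _ _ KdL fL)) (oL _ _ rL fL)) _.
  rewrite nrm2Z ?oL// gtr0_norm// mulrDl -mulrA lerD//.
    by rewrite ler_pM2l//; exact: (kernel_operator_L2 KdL fL).2.
  exact: (kernel_operator_L2 rL fL).2.
pose w := (fun x => t^-1 * (f \- f0) x) \- s.
have wL : w \in L2 by apply: Lfun2B => //; exact: Lfun2Z.
rewrite (_ : (fun x => _) = w); last first.
  by apply/funext => x; rewrite /w /= mulrC.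
have e9 := kernel_operatorB sK0L (Lfun2Z t^-1 ffL) sL.
have e10 := kernel_operatorZr t^-1 sK0L ffL.
have e910 : w \- op (shift K0) w =
    (fun x => t^-1 * ((f \- f0) \- op (shift K0) (f \- f0)) x
     - (s \- op (shift K0) s) x) %[ae mu].
  apply: filterS2 e9 e10 => x /(_ I) a /(_ I) b _.
  have -> : (w \- op (shift K0) w) x = (t^-1 * (f x - f0 x) - s x) -
      (t^-1 * op (shift K0) (f \- f0) x - op (shift K0) s x) by rewrite -b -[X in _ - X]a.
  by rewrite /=; ring.
have e83 : (fun x => t^-1 * ((f \- f0) \- op (shift K0) (f \- f0)) x
     - (s \- op (shift K0) s) x) =
    (fun x => op Kdot f x - op Kdot f0 x + t^-1 * op r f x) %[ae mu].
  apply: filterS2 e8 e3 => x /(_ I) -> /(_ I) -> _ /=.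
  by field; rewrite gt_eqF.
have e : w \- op (shift K0) w = op Kdot (f \- f0) \+ (fun x => t^-1 * op r f x) %[ae mu].
  have e11 : w \- op (shift K0) w =
      (fun x => op Kdot f x - op Kdot f0 x + t^-1 * op r f x) %[ae mu].
    by apply: filterS2 e910 e83 => x /(_ I) -> /(_ I) -> _.
  by apply: filterS2 e11 e7 => x /(_ I) -> /(_ I) /= -> _.
have rhsL := Lfun2D (oL _ _ KdL ffL) (Lfun2Z t^-1 (oL _ _ rL fL)).
apply: le_trans (low0 _ wL) _.
rewrite (nrm2_eq (hL _ _ sK0L wL) rhsL ((nrm2B_eq0 (hL _ _ sK0L wL) rhsL).2 e)).
rewrite -mulrA ler_wpM2l//.
apply: le_trans (nrm2D (oL _ _ KdL ffL) (Lfun2Z t^-1 (oL _ _ rL fL))) _.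
rewrite nrm2Z ?oL// gtr0_norm ?invr_gt0// mulrDl lerD//.
  apply: le_trans (kernel_operator_L2 KdL ffL).2 _.
  rewrite -[leRHS]mulrA ler_wpM2l ?nrm2_ge0// (le_trans ff_le)//.
  rewrite mulrA ler_wpM2l// mulr_ge0// addr_ge0 ?nrm2_ge0// mulr_ge0 ?nrm2_ge0//.
  exact: ltW.
rewrite [leRHS](_ : _ = t^-1 * (nrmK r * (2 * C * nrm one))); last by ring.
rewrite ler_pM2l ?invr_gt0//.
by rewrite (le_trans (kernel_operator_L2 rL fL).2)// ler_wpM2l ?nrm2_ge0.
Qed.

End response.

(** * Lebesgue measure on the unit interval, the threshold [d0] and the limit *)

Unset Implicit Arguments.

Theorem corollary3p5 (R : realType) (dbar : R) (dbar_gt0 : 0 < dbar)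
    (k : R -> R * R -> R) (kdot : R * R -> R) (r : R -> R * R -> R)
    (L : R -> (R -> R) -> R -> R)
    (LE : forall d, 0 <= d < dbar -> L d = integral_operator (k d))
    (k_L2 : forall d, 0 <= d < dbar -> L2ker (k d))
    (k_stoch : forall d, 0 <= d < dbar -> stochastic_kernel (k d))
    (L_int : forall d, 0 <= d < dbar -> integral_preserving (L d))
    (kdot_L2 : L2ker kdot)
    (r_L2 : forall d, 0 <= d < dbar -> L2ker (r d))
    (kE : forall d, 0 <= d < dbar ->
      k d = (fun p => k 0 p + d * kdot p + r d p) %[ae leb01sq])
    (r_small : (fun d : R => fine (L2kernorm (r d))) =o_ (0^'+) (fun d : R => d))
    (L0_A1 : convergence_to_equilibrium (L 0)) :
  Vker kdot /\
  exists2 d0 : R, 0 < d0 <= dbar &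
    (forall d, 0 <= d < d0 ->
      (exists f, normalized_invariant (L d) f) /\
      (forall f g, normalized_invariant (L d) f ->
         normalized_invariant (L d) g -> f = g %[ae leb01])) /\
    exists2 S : (R -> R) -> R -> R, bounded_inverse_on_V (L 0) S &
      forall f : R -> R -> R,
        (forall d, 0 <= d < d0 -> normalized_invariant (L d) (f d)) ->
        L2norm (fun x => (f d x - f 0 x) / d -
                         S (integral_operator kdot (f 0)) x)
          @[d --> 0^'+] --> 0%E.
Proof.
pose mu : {finite_measure set (measurableTypeR R) -> \bar R} := @leb01 R.
pose nrm := nrm2 mu; pose nrmK := nrm2 (mu \x mu)%E; pose op := kernel_operator mu.
pose shift (K : R * R -> R) := K \- (cst 1 : R * R -> R).
have mu1 : (mu : {measure set _ -> \bar R}) setT = 1%E.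
  rewrite /mu /= /leb01 /mrestr setTI lebesgue_measure_itv/= lte_fin ltr01.
  by rewrite EFinN sube0.
have zin : 0 <= (0 : R) < dbar by rewrite lexx.
have kL d : 0 <= d < dbar -> k d \in Lfun (mu \x mu)%E 2%:E := k_L2 d.
have rL d : 0 <= d < dbar -> r d \in Lfun (mu \x mu)%E 2%:E := r_L2 d.
have k0L := kL 0 zin; have KdL : kdot \in Lfun (mu \x mu)%E 2%:E := kdot_L2.
have kp d : 0 <= d < dbar -> mean_preserving mu (k d).
  by move=> dd g gL; have := L_int d dd g gL; rewrite (LE d dd).
have kX d : 0 <= d < dbar -> kernel_expansion mu (k d) (k 0) kdot (r d) d := kE d.
have rs e : 0 < e -> exists2 d1 : R, 0 < d1 &
    forall d, 0 < d -> d < d1 -> nrmK (r d) <= e * d.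
  move=> e0; have /eqoP/(_ e e0) := r_small.
  move=> [d1 /= d10 H]; exists d1 => // d d_gt0 dd1.
  have := H d; rewrite /= sub0r normrN gtr0_norm// => /(_ dd1 d_gt0).
  by move=> /(le_trans (ler_norm _)).
have kdot0 : {ae mu, forall y, \int[mu]_x kdot (x, y) = 0}.
  apply: (mean_column_eq0 mu1 k0L KdL (kp 0 zin)) => e e0.
  have [d1 d10 H] := rs e e0; pose t := Num.min d1 dbar / 2.
  have m0 : 0 < Num.min d1 dbar by rewrite lt_min d10.
  have t0 : 0 < t by rewrite divr_gt0.
  have tm : t < Num.min d1 dbar by rewrite /t; lra.
  have /andP[td1 td] : (t < d1) && (t < dbar) by move: tm; rewrite lt_min.
  have tin : 0 <= t < dbar by rewrite ltW.
  exists t, (k t), (r t); split=> //; split=> //.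
  - exact: kL.
  - exact: rL.
  - exact: kp.
  - exact: kX.
  - exact: H.
split; first by split.
have [C [C0 invC]] : exists C, 0 <= C /\ invertible_sub1 mu (op (shift (k 0))) C.
  apply: (shift_invertible mu1 k0L (kp 0 zin)).
    exact: (k_stoch 0 zin).2.
  move=> g gL g0; have := L0_A1 g (conj gL g0); rewrite (LE 0 zin) => /fine_cvgP[_].
  exact.
pose a := nrmK kdot; have a0 : 0 <= a by exact: nrm2_ge0.
have [d1 d10 Hd1] := rs 1 ltr01.
(* With [nrmK (r d) <= d] and [d < c^-1] this gives [C * (d * a + nrmK (r d)) <= 2^-1], the
   smallness asked by [shift_perturbation]. The added ones make [c] positive. *)
pose c := 2 * (C + 1) * (a + 1).
have c0 : 0 < c by rewrite /c; nra.
pose d0 := Num.min dbar (Num.min d1 c^-1).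
have d00 : 0 < d0 by rewrite !lt_min dbar_gt0 d10 invr_gt0.
have d0P d : d < d0 -> [/\ d < dbar, d < d1 & d < c^-1].
  by rewrite !lt_min => /andP[-> /andP[-> ->]].
(* At [d = 0] the unperturbed inverse serves directly, because [Hd1] controls [r d] for positive [d]
   only; the uniform constant [2 * C] is recorded for [d > 0]. *)
have invd d : 0 <= d < d0 -> exists C', invertible_sub1 mu (op (shift (k d))) C' /\
    (0 < d -> C' = 2 * C).
  move=> /andP[d_ge0 dd0]; have [ddbar dd1 dc] := d0P d dd0.
  move: d_ge0; rewrite le_eqVlt => /orP[/eqP <-|d_gt0].
    by exists C; split=> //; rewrite ltxx.
  exists (2 * C); split=> //; have din : 0 <= d < dbar by rewrite ltW.
  apply: (shift_perturbation (kL d din) k0L KdL (rL d din) (ltW d_gt0) (kX d din)) => //.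
  have := Hd1 d d_gt0 dd1; rewrite mul1r => rd.
  have : d * c < 1 by rewrite -ltr_pdivlMr// mul1r.
  rewrite /c => dc1; rewrite -/nrmK -/a.
  apply: (@le_trans _ _ (C * (d * (a + 1)))).
    by rewrite ler_wpM2l// mulrDr mulr1 lerD2l.
  have : 0 <= d * (a + 1) by rewrite mulr_ge0 ?addr_ge0// ltW.
  lra.
have invP d f : 0 <= d < dbar -> normalized_invariant (L d) f <->
    f \in Lfun mu 2%:E /\ nrm ((f \- op (shift (k d)) f) \- cst 1) = 0.
  move=> din; rewrite /normalized_invariant (LE d din); split.
    move=> [fL f1 Lf]; split=> //.
    exact/(invariant_shiftP mu1 (kL d din) (kp d din) fL).
  move=> [fL]; move=> /(invariant_shiftP mu1 (kL d din) (kp d din) fL)[f1 Lf].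
  by split.
have bar d : 0 <= d < d0 -> 0 <= d < dbar.
  by move=> /andP[-> dd0] /=; case: (d0P d dd0).
have opS K : K \in Lfun (mu \x mu)%E 2%:E -> forall h, h \in Lfun mu 2%:E ->
    op K h \in Lfun mu 2%:E by move=> KL h hL; exact: kernel_operator_stable.
have opsS K : K \in Lfun (mu \x mu)%E 2%:E -> forall h, h \in Lfun mu 2%:E ->
    op (shift K) h \in Lfun mu 2%:E by move=> KL; apply: opS; exact: shift_L2.
have bnd_shift d : 0 <= d < dbar ->
    bounded_linear_L2 mu (op (shift (k d))) (nrmK (shift (k d))).
  by move=> din; apply: kernel_operator_bounded; apply: shift_L2; exact: kL.
exists d0; first by rewrite d00 /= /d0 ge_min lexx.
split.
  move=> d din; have [C' [invd' _]] := invd d din; split.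
    have [h hL hE] := invd'.1 (cst 1) (Lfun2_one mu).
    by exists h; apply/(invP d h (bar d din)).
  move=> f g /(invP d f (bar d din))[fL fE] /(invP d g (bar d din))[gL gE].
  apply/(nrm2B_eq0 fL gL).
  exact: (invertible_sub1_inj (bnd_shift d (bar d din)) invd' fL gL (Lfun2_one mu)).
have [surj low] := invC.
(* [S] solves the shifted equation on all of L^2. On [V] it inverts [Id - L 0], since solutions with
   mean-zero data have mean zero and there the two operators agree. *)
have /choice[S SP] : forall g, exists h, g \in Lfun mu 2%:E ->
    h \in Lfun mu 2%:E /\ nrm ((h \- op (shift (k 0)) h) \- g) = 0.
  move=> g; have [gL|gL] := boolP (g \in Lfun mu 2%:E); last by exists g.
  by have [h hL hE] := surj g gL; exists h.
have s0L := opsS _ k0L.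
have SV g : V g -> V (S g).
  move=> [gL g0]; have [SL SE] := SP g gL; split=> //.
  have := mean_nrm2_eq (Lfun2B SL (s0L _ SL)) gL SE.
  rewrite (meanB SL (s0L _ SL)) (mean_shift mu1 k0L (kp 0 zin) SL) subr0 => ->.
  exact: g0.
exists S.
  rewrite (LE 0 zin); split=> //.
  - exists C => g [gL g0]; have [SL SE] := SP g gL.
    have dL := Lfun2B SL (s0L _ SL).
    rewrite /L2norm -(nrm2K (mu := mu) SL) -(nrm2K (mu := mu) gL) -EFinM lee_fin.
    by rewrite -(nrm2_eq dL gL SE); exact: low.
  - move=> g gV; have [gL g0] := gV; have [SL SE] := SP g gL.
    have [_ S0] := SV g gV.
    have e1 := (nrm2B_eq0 (Lfun2B SL (s0L _ SL)) gL).1 SE.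
    have e2 := shift_mean0 k0L SL S0.
    apply: filterS2 e1 e2 => x /(_ I) e1 /(_ I) e2 _.
    transitivity (S g x - kernel_operator mu (k 0) (S g) x) => //.
    by rewrite -e2.
  (* Both [S u] and [g] solve the shifted equation with right-hand side [u], so they agree by
     injectivity. *)
  - move=> g [gL g0]; pose u := g \- integral_operator (k 0) g.
    have kgL := opS _ k0L _ gL; have uL : u \in Lfun mu 2%:E := Lfun2B gL kgL.
    have [SL SE] := SP u uL.
    apply/(nrm2B_eq0 SL gL).
    apply: (invertible_sub1_inj (bnd_shift 0 zin) invC SL gL uL SE).
    apply/(nrm2B_eq0 (Lfun2B gL (s0L _ gL)) uL).
    apply: filterS (shift_mean0 k0L gL g0) => x /(_ I) e _.
    by transitivity (g x - kernel_operator mu (k 0) g x) => //; rewrite -e.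
move=> f fP.
have f0L : f 0 \in Lfun mu 2%:E.
  by have [] := fP 0 (_ : 0 <= 0 < d0); rewrite ?lexx.
have f0E : nrm ((f 0 \- op (shift (k 0)) (f 0)) \- cst 1) = 0.
  have h0 : 0 <= (0 : R) < d0 by rewrite lexx.
  by have /(invP 0 (f 0) zin)[] := fP 0 h0.
set s := S _; have gL : integral_operator kdot (f 0) \in Lfun mu 2%:E.
  exact: (opS _ KdL _ f0L).
have [sL sE] := SP _ gL; rewrite -/s in sL sE.
(* The bound of [response_bound] with [nrmK (r d)] replaced by [rho * d]: the division by [d]
   disappears, and what remains is a polynomial in [d] and [rho] that vanishes at [(0, 0)]. *)
pose bnd d rho := C * (a * (C * (d * a + rho * d)) + rho) * (2 * C * nrm (cst 1)).
have wbnd d rho : 0 < d -> d < d0 -> nrmK (r d) <= rho * d ->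
    (L2norm (fun x => (f d x - f 0 x) / d - s x)%R <= (bnd d rho)%:E)%E.
  move=> d_gt0 dd0 rd; have din0 : 0 <= d < d0 by rewrite ltW.
  have din := bar d din0; have /(invP d (f d) din)[fL fE] := fP d din0.
  have [C' [invC' C'E]] := invd d din0; rewrite (C'E d_gt0) in invC'.
  have := response_bound (kL d din) k0L KdL (rL d din) d_gt0 (kX d din) C0 invC
    invC' fL f0L sL fE f0E sE.
  have wL : (fun x => (f d x - f 0 x) / d - s x) \in Lfun mu 2%:E.
    rewrite (_ : (fun x => _) = (fun x => d^-1 * (f d \- f 0) x) \- s); last first.
      by apply/funext => x /=; rewrite mulrC.
    by apply: Lfun2B => //; apply: Lfun2Z; exact: Lfun2B.
  rewrite /L2norm -(nrm2K (mu := mu) wL) lee_fin => /le_trans; apply.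
  have n1 : 0 <= nrm (cst 1) by exact: nrm2_ge0.
  rewrite /bnd ler_wpM2r ?mulr_ge0// ler_wpM2l// lerD//.
    by rewrite ler_wpM2l// ler_wpM2l// lerD2l.
  by rewrite ler_pdivrMr.
pose rho d := nrmK (r d) / d.
have nearpos : \forall d \near (0 : R)^'+, 0 < d < d0.
  near=> d; apply/andP; split; near: d; first exact: nbhs_right_gt.
  exact: nbhs_right_lt.
have d_cvg : (d : R) @[d --> (0 : R)^'+] --> (0 : R).
  by apply: cvg_at_right_filter; exact: cvg_id.
have rho_cvg : rho d @[d --> (0 : R)^'+] --> (0 : R).
  apply/cvgr0Pnorm_le => e e0; have [d2 d20 H] := rs e e0.
  near=> d; have d_gt0 : 0 < d by near: d; exact: nbhs_right_gt.
  rewrite /rho ger0_norm; last by rewrite divr_ge0 ?nrm2_ge0 ?(ltW d_gt0).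
  by rewrite ler_pdivrMr//; apply: H => //; near: d; exact: nbhs_right_lt.
have bnd_cvg : bnd d (rho d) @[d --> (0 : R)^'+] --> (0 : R).
  have b0 : bnd 0 0 = 0 by rewrite /bnd; ring.
  rewrite -[X in _ --> X]b0.
  apply: cvgM; last exact: cvg_cst.
  apply: cvgM; first exact: cvg_cst.
  apply: cvgD; last exact: rho_cvg.
  apply: cvgM; first exact: cvg_cst.
  apply: cvgM; first exact: cvg_cst.
  apply: cvgD; apply: cvgM => //; exact: cvg_cst.
apply: (@squeeze_cvge _ _ _ _ (cst 0%E) _ (fun d => (bnd d (rho d))%:E)).
- apply: filterS nearpos => d /andP[d_gt0 dd0]; rewrite Lnorm_ge0/=.
  by apply: wbnd => //; rewrite /rho divfK// gt_eqF.
- exact: cvg_cst.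
- by apply: cvg_EFin => //; exact: nearW.
Unshelve. all: by end_near. Qed.
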